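(* Let $d\ge2$ be an integer. For any fixed real $n>d/2$, one has $(K_{pn})^{1/p}\to2$ for $p\to+\infty$ ($p$ real, $p\ge n$).
   Context: Notation. $\mathbf T^d=(\mathbf R/2\pi\mathbf Z)^d$; $e_k(x)=(2\pi)^{-d/2}e^{ik\cdot x}$ for $k\in\mathbf Z^d$; $a\cdot b=\sum_ra_rb_r$ and $|a|=\sqrt{\overline a\cdot a}$ on $\mathbf C^d$; $\mathbf Z^d_0=\mathbf Z^d\setminus\{0\}$. An $\mathbf R^d$-valued distribution on $\mathbf T^d$ has a Fourier expansion $v=\sum_kv_ke_k$, $v_k=\overline{v_{-k}}\in\mathbf C^d$. For real $m$, $\mathbb H^m$ is the space of such $v$ with $k\cdot v_k=0$ for all $k$, $v_0=0$ and $\|v\|_m^2:=\sum_{k\in\mathbf Z^d_0}|k|^{2m}|v_k|^2<\infty$. The Leray projection $\mathfrak L$ acts by $(\mathfrak Lv)_k=v_k-\frac{k\cdot v_k}{|k|^2}k$ for $k\ne0$, $(\mathfrak Lv)_0=v_0$. $\mathcal P(v,w)=\mathfrak L(v\cdot\partial w)$, $(v\cdot\partial w)_s=\sum_{r=1}^dv_r\partial_rw_s$; for $p>d/2$ it maps $\mathbb H^p\times\mathbb H^{p+1}$ to $\mathbb H^p$. For $p\ge n>d/2$, $K_{pn}$ is the sharp (i.e. minimum) constant $K$ such that $\|\mathcal P(v,w)\|_p\le\frac12K(\|v\|_p\|w\|_{n+1}+\|v\|_n\|w\|_{p+1})$ for all $v\in\mathbb H^p$, $w\in\mathbb H^{p+1}$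 (such constants exist). *)

(* Defs.v *)
From HB Require Import structures.
From mathcomp Require Import all_boot all_order all_algebra.
From mathcomp Require Import all_classical all_reals all_analysis.
From mathcomp Require Import complex.

Set Implicit Arguments.
Unset Strict Implicit.
Unset Printing Implicit Defensive.

Import Order.TTheory GRing.Theory Num.Theory numFieldNormedType.Exports.

Local Open Scope classical_set_scope.
Local Open Scope complex_scope.
Local Open Scope ring_scope.

(* Unordered sums. Only meaningful for absolutely summable families. *)

Definition rsum (R : realType) (I : choiceType) (f : I -> R) : R :=
  fine (\esum_(i in [set: I]) (Num.max (f i) 0)%:E)
  - fine (\esum_(i in [set: I]) (Num.max (- f i) 0)%:E).

Definition csum (R : realType) (I : choiceType) (f : I -> R[i]) : R[i] :=
  rsum (fun i => complex.Re (f i)) +i* rsum (fun i => complex.Im (f i)).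

(* Bilinear (not sesquilinear), also over the complex numbers. *)
Definition dot (A : pzRingType) (d : nat) (a b : 'rV[A]_d) : A :=
  \sum_(r < d) a 0 r * b 0 r.

Definition vnorm (R : realType) (d : nat) (a : 'rV[R[i]]_d) : R :=
  Num.sqrt (complex.Re (dot (map_mx conjc a) a)).

Definition toC (R : realType) (d : nat) (k : 'rV[int]_d) : 'rV[R[i]]_d :=
  map_mx intr k.

Definition e_ (R : realType) (d : nat) (k : 'rV[int]_d) (x : 'rV[R]_d) : R[i] :=
  ((2 * pi) `^ (- (d%:R / 2)))%:C
  * (cos (dot (map_mx intr k) x) +i* sin (dot (map_mx intr k) x)).

(* Distributions on the torus are represented by the family of coefficients
   (u_k) of their Fourier expansion; functions on the torus are functions on
   R^d restricted to one period. The growth condition characterizing the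
   coefficients of a distribution is implied by the finiteness of a Sobolev
   norm, the only case used below. *)
Definition dist (R : realType) (d : nat) : Type := 'rV[int]_d -> R[i].
Definition vdist (R : realType) (d : nat) : Type := 'rV[int]_d -> 'rV[R[i]]_d.

Definition component (R : realType) (d : nat) (v : vdist R d) (s : 'I_d) :
  dist R d := fun k => v k 0 s.

Definition partial (R : realType) (d : nat) (r : 'I_d) (u : dist R d) :
  dist R d := fun k => (0 +i* 1) * (k 0 r)%:~R * u k.

(* The function sum_k u_k e_k, for absolutely summable (u_k). *)
Definition tofun (R : realType) (d : nat) (u : dist R d) (x : 'rV[R]_d) :
  R[i] := csum (fun k => u k * e_ k x).

(* Iterated integral over [0, 2 pi]^d; by Fubini's theorem it is the integral
   over the torus, in particular for continuous functions. *)
Fixpoint torus_integral (R : realType) (d : nat) : ('rV[R]_d -> R) -> R :=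
  match d with
  | 0 => fun f => f 0
  | d'.+1 => fun f =>
      \int[@lebesgue_measure R]_(t in `[0, 2 * pi])
        torus_integral (fun x : 'rV[R]_d' => f (row_mx (t%:M : 'rV[R]_1) x))
  end.

Definition fourier (R : realType) (d : nat) (f : 'rV[R]_d -> R[i]) : dist R d :=
  fun k => torus_integral (fun x => complex.Re (conjc (e_ k x) * f x))
           +i* torus_integral (fun x => complex.Im (conjc (e_ k x) * f x)).

(* v . d w, from the pointwise product of the functions v_r and d_r w_s *)
Definition advection (R : realType) (d : nat) (v w : vdist R d) : vdist R d :=
  fun k => \row_(s < d)
    fourier (fun x => \sum_(r < d) tofun (component v r) x
                                   * tofun (partial r (component w s)) x) k.

Definition leray (R : realType) (d : nat) (v : vdist R d) : vdist R d :=
  fun k => if k == 0 then v 0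
    else v k - (dot (toC R k) (v k) / (vnorm (toC R k) ^+ 2)%:C) *: toC R k.

Definition P_ (R : realType) (d : nat) (v w : vdist R d) : vdist R d :=
  leray (advection v w).

Definition hnorm (R : realType) (d : nat) (m : R) (v : vdist R d) : \bar R :=
  sqrte (\esum_(k in [set k : 'rV[int]_d | k != 0])
           (vnorm (toC R k) `^ (2 * m) * vnorm (v k) ^+ 2)%:E).

Definition H_ (R : realType) (d : nat) (m : R) : set (vdist R d) :=
  [set v | [/\ forall k, v k = map_mx conjc (v (- k)),
               forall k, dot (toC R k) (v k) = 0,
               v 0 = 0 &
               (hnorm m v < +oo)%E]].

Definition admissible (R : realType) (d : nat) (p n : R) : set R :=
  [set K | forall v w : vdist R d, H_ p v -> H_ (p + 1) w ->
     (hnorm p (P_ v w)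
       <= (2^-1 * K)%:E * (hnorm p v * hnorm (n + 1) w
                           + hnorm n v * hnorm (p + 1) w))%E].

(* The minimum of the admissible constants (0 if there were none). *)
Definition sharpK (R : realType) (d : nat) (p n : R) : R :=
  xget 0 [set K | admissible d p n K /\ lbound (admissible d p n) K].

(* Main.v *)
Require Import Defs.
From mathcomp Require Import all_boot all_order all_algebra.
From mathcomp Require Import all_classical all_reals all_analysis.
From mathcomp Require Import complex ring lra zify.
Import Order.TTheory GRing.Theory Num.Theory numFieldNormedType.Exports.
Local Open Scope classical_set_scope.
Local Open Scope ring_scope.
Set Implicit Arguments.
Unset Strict Implicit.

(** Why the limit is 2.  The number 2 is the constant in
|k|^p <= 2^p (|h|^p + |l|^p) for k = h + l, which is sharp up to a factor
independent of p: it is reached when h and l are nearly equal.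

Upper bound.  The k-th Fourier coefficient of v . d w is, up to the factor
i (2 pi)^(-d/2), the sum over h of (v_h . (k - h)) w_(k-h), so its size is at
most a constant times the convolution of |v_h| with |l| |w_l|, and the Leray
projection costs at most another constant.  Multiplying by |k|^p and splitting
it as above leaves two convolutions, of |h|^p |v_h| with |l| |w_l| and of |v_h|
with |l|^(p+1) |w_l|.  Young's inequality bounds each in l^2 by the l^2 norm of
the factor that carries the large power times the l^1 norm of the other one.
By Cauchy-Schwarz these l^1 norms are controlled by the norms of index n
and n + 1, because the sum of |k|^(-2n) over nonzero k converges for n > d/2.
Hence C 2^p is admissible, with C independent of p (admissible_pow2).

Lower bound.  Let v be carried by the frequencies (N, -1) and its opposite,
with coefficient (1, N), and w by (N, 1) and its opposite, with coefficient
(1, -N), the other coordinates being 0.  All these vectors have length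
M = sqrt (N^2 + 1), whereas the product has the nonzero coefficient of index
(2N, 0).  Comparing the two sides of the inequality shows that every
admissible K is at least c_N (2N / M)^p (admissible_ge_pow).

Conclusion.  The admissible constants form a closed set, so the sharp one lies
between c_N (2N / M)^p and C 2^p (sharpK_between).  Taking p-th roots, the
factors c_N and C disappear in the limit, and 2N / M tends to 2 as N grows.

The link between the pointwise product and the convolution comes from
fourier_prod_approx.  An absolutely convergent Fourier series is a uniform
limit of its partial sums, so it is bounded and uniformly continuous;
on such functions the iterated integral is linear and continuous for uniform
convergence, and on products of partial sums it is computed explicitly.
Infinite sums are handled throughout as bounds, uniform in the finite
duplicate-free sequence s, on the sums over s.  Constants independent of p are
not optimized. *)

(** * Integration of uniformly continuous functions over the torus *)

(** The class of bounded uniformly continuous functions is stable under products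
and uniform limits, and partial integration stays inside it, which continuity
alone would not give without a compactness argument at each step. *)
Definition bucont (R : realType) (d : nat) (f : 'rV[R]_d -> R) : Prop :=
  (exists M : R, forall x, `|f x| <= M) /\
  (forall e : R, 0 < e -> exists2 a : R, 0 < a &
     forall x y : 'rV[R]_d, (forall i, `|x 0 i - y 0 i| <= a) ->
       `|f x - f y| <= e).

Lemma bucont_cst (R : realType) (d : nat) (c : R) :
  bucont (fun _ : 'rV[R]_d => c).
Proof.
split; first by exists `|c|.
by move=> e e0; exists 1 => // x y _; rewrite subrr normr0 ltW.
Qed.

Lemma bucontD (R : realType) (d : nat) (f g : 'rV[R]_d -> R) :
  bucont f -> bucont g -> bucont (fun x => f x + g x).
Proof.
move=> [[M fM] fu] [[N gN] gu]; split.
  by exists (M + N) => x; rewrite (le_trans (ler_normD _ _))// lerD.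
move=> e e0; have e20 : 0 < e / 2 by rewrite divr_gt0.
have [a a0 fa] := fu _ e20; have [b b0 gb] := gu _ e20.
exists (Num.min a b); first by rewrite lt_min a0.
move=> x y xy.
have -> : f x + g x - (f y + g y) = (f x - f y) + (g x - g y) by ring.
rewrite (le_trans (ler_normD _ _))// [leRHS](splitr e) lerD//.
  by apply: fa => i; rewrite (le_trans (xy i))// ge_min lexx.
by apply: gb => i; rewrite (le_trans (xy i))// ge_min lexx orbT.
Qed.

Lemma bucontM (R : realType) (d : nat) (f g : 'rV[R]_d -> R) :
  bucont f -> bucont g -> bucont (fun x => f x * g x).
Proof.
move=> [[M fM] fu] [[N gN] gu].
have M0 : 0 <= M by rewrite (le_trans _ (fM 0)).
have N0 : 0 <= N by rewrite (le_trans _ (gN 0)).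
split; first by exists (M * N) => x; rewrite normrM ler_pM.
move=> e e0; set K := M + N + 1.
have K0 : 0 < K by rewrite /K ltr_wpDl// addr_ge0.
have eK : 0 < e / K by rewrite divr_gt0.
have [a a0 fa] := fu _ eK; have [b b0 gb] := gu _ eK.
exists (Num.min a b); first by rewrite lt_min a0.
move=> x y xy.
have Hf : `|f x - f y| <= e / K.
  by apply: fa => i; rewrite (le_trans (xy i))// ge_min lexx.
have Hg : `|g x - g y| <= e / K.
  by apply: gb => i; rewrite (le_trans (xy i))// ge_min lexx orbT.
have -> : f x * g x - f y * g y = f x * (g x - g y) + (f x - f y) * g y by ring.
rewrite (le_trans (ler_normD _ _))// !normrM.
apply: (@le_trans _ _ (M * (e / K) + (e / K) * N)).
  by rewrite lerD// ler_pM.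
have -> : M * (e / K) + e / K * N = (M + N) * (e / K) by ring.
rewrite mulrA ler_pdivrMr// mulrC ler_pM2l// /K lerDl ler01 //.
Qed.

Lemma bucontZ (R : realType) (d : nat) (c : R) (f : 'rV[R]_d -> R) :
  bucont f -> bucont (fun x => c * f x).
Proof. by move=> bf; apply: bucontM => //; exact: bucont_cst. Qed.

Lemma bucontN (R : realType) (d : nat) (f : 'rV[R]_d -> R) :
  bucont f -> bucont (fun x => - f x).
Proof.
move=> /(bucontZ (-1)); congr bucont; apply/funext => x; exact: mulN1r.
Qed.

(** An epsilon / 3 argument; it makes absolutely convergent Fourier series
uniformly continuous. *)
Lemma bucont_lim (R : realType) (d : nat) (f : 'rV[R]_d -> R) :
  (forall e : R, 0 < e -> exists2 g, bucont g & forall x, `|f x - g x| <= e) ->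
  bucont f.
Proof.
move=> fg; split.
  have [g [[M gM] _] H] := fg 1 ltr01.
  exists (1 + M) => x; rewrite -(subrK (g x) (f x)).
  by rewrite (le_trans (ler_normD _ _))// lerD.
move=> e e0; have e30 : 0 < e / 3 by rewrite divr_gt0.
have [g [_ gu] H] := fg _ e30.
have [a a0 ga] := gu _ e30; exists a => // x y xy.
have -> : f x - f y = (f x - g x) + (g x - g y) - (f y - g y) by ring.
rewrite (le_trans (ler_normB _ _))//.
have -> : e = e / 3 + e / 3 + e / 3 by field.
by rewrite lerD// (le_trans (ler_normD _ _))// lerD// ga.
Qed.

(** Mean value theorem, the derivative being bounded by 1. *)
Lemma cos_lipschitz (R : realType) (x y : R) : `|cos x - cos y| <= `|x - y|.
Proof.
wlog xy : x y / y < x => [H|].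
  have [/eqP->|] := boolP (x == y); first by rewrite !subrr.
  by rewrite neq_lt => /orP[/H|/H//]; rewrite (distrC (cos y)) (distrC y).
have [c _ ->] := @MVT R cos (fun z => - sin z) _ _ xy
  (fun z _ => is_derive_cos z)
  (@continuous_subspaceT _ _ _ _ (@continuous_cos R)).
by rewrite normrM normrN ler_piMl// sin_max.
Qed.

Lemma bucont_cos (R : realType) (d : nat) (m : 'rV[R]_d) (t : R) :
  bucont (fun x => cos (dot m x + t)).
Proof.
split; first by exists 1 => x; exact: cos_max.
move=> e e0; set S := \sum_(r < d) `|m 0 r| + 1.
have S0 : 0 < S by rewrite /S ltr_wpDl// sumr_ge0.
(* S is a Lipschitz constant of x |-> m . x for the maximum norm *)
exists (e / S); first by rewrite divr_gt0.
move=> x y xy; apply: (le_trans (cos_lipschitz _ _)).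
have -> : dot m x + t - (dot m y + t) = \sum_(r < d) m 0 r * (x 0 r - y 0 r).
  rewrite opprD addrACA subrr addr0 -sumrB; apply: eq_bigr => r _; ring.
apply: (le_trans (ler_norm_sum _ _ _)).
apply: (@le_trans _ _ (\sum_(r < d) `|m 0 r| * (e / S))).
  by apply: ler_sum => r _; rewrite normrM ler_wpM2l.
rewrite -mulr_suml mulrA ler_pdivrMr// mulrC ler_pM2l// /S lerDl ler01//.
Qed.

Lemma row_cons0 (R : realType) (d : nat) (t : R) (x : 'rV[R]_d) :
  (row_mx (t%:M : 'rV[R]_1) x : 'rV[R]_d.+1) 0 ord0 = t.
Proof.
have -> : ord0 = lshift d (0 : 'I_1) :> 'I_(1 + d) by apply: val_inj.
by rewrite (@row_mxEl _ 1 1 d) mxE eqxx.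
Qed.

Lemma row_consS (R : realType) (d : nat) (t : R) (x : 'rV[R]_d) (i : 'I_d) :
  (row_mx (t%:M : 'rV[R]_1) x : 'rV[R]_d.+1) 0 (lift ord0 i) = x 0 i.
Proof.
have -> : lift ord0 i = rshift 1 i :> 'I_(1 + d) by apply: val_inj.
exact: (@row_mxEr _ 1 1 d).
Qed.

Lemma bucont_slice (R : realType) (d : nat) (f : 'rV[R]_d.+1 -> R) (t : R) :
  bucont f -> bucont (fun x : 'rV[R]_d => f (row_mx (t%:M : 'rV[R]_1) x)).
Proof.
move=> [[M fM] fu]; split; first by exists M.
move=> e e0; have [a a0 fa] := fu _ e0; exists a => // x y xy.
apply: fa => i; case: (unliftP ord0 i) => [j ->|->].
  by rewrite !row_consS.
by rewrite !row_cons0 subrr normr0 ltW.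
Qed.

Lemma unif_integrable (R : realType) (f : R -> R) (a b : R) :
  (forall e : R, 0 < e -> exists2 a : R, 0 < a &
     forall x y, `|x - y| <= a -> `|f x - f y| <= e) ->
  (@lebesgue_measure R).-integrable `[a, b] (EFin \o f).
Proof.
move=> fu; apply: continuous_compact_integrable; first exact: segment_compact.
apply: continuous_subspaceT => x.
apply/cvgrPdist_le => e e0; have [c c0 fc] := fu _ e0.
near=> y; apply: fc.
near: y; apply: (@cvgr_dist_le _ _ _ _ _ id x) => //; exact: cvg_id.
Unshelve. all: by end_near. Qed.

Lemma measure_period (R : realType) :
  fine (@lebesgue_measure R `[0, 2 * pi]) = 2 * pi.
Proof.
by rewrite lebesgue_measure_itv/= lte_fin mulr_gt0 ?pi_gt0//= subr0.
Qed.

Lemma Rintegral_period_le (R : realType) (f : R -> R) (M : R) :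
  (@lebesgue_measure R).-integrable `[0, 2 * pi] (EFin \o f) ->
  (forall t, `|f t| <= M) ->
  `|\int[@lebesgue_measure R]_(t in `[0, 2 * pi]) f t| <= 2 * pi * M.
Proof.
move=> fi fM; apply: (le_trans (le_normr_Rintegral _ _)) => //.
rewrite -[X in X * M](measure_period R) [leRHS]mulrC.
rewrite -(Rintegral_cst (@lebesgue_measure R) (measurable_itv _) M).
apply: le_Rintegral => //.
- exact: integrable_norm fi.
- apply: unif_integrable => e e0; exists 1 => // x y _.
  by rewrite subrr normr0 ltW.
Qed.

(** The three properties have to be proved together, by induction on the
dimension: the integrability of the partial integral in the first variable
follows from its uniform continuity, which is obtained by applying linearity and
the bound, in one dimension less, to the difference of two slices. *)
Lemma torus_integral_unif (R : realType) (d : nat) :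
  [/\ forall f g : 'rV[R]_d -> R, bucont f -> bucont g ->
        torus_integral (fun x => f x + g x) =
        torus_integral f + torus_integral g,
      forall (c : R) (f : 'rV[R]_d -> R), bucont f ->
        torus_integral (fun x => c * f x) = c * torus_integral f &
      forall (f : 'rV[R]_d -> R) (M : R), bucont f -> (forall x, `|f x| <= M) ->
        `|torus_integral f| <= (2 * pi) ^+ d * M].
Proof.
elim: d => [|d [IHD IHZ IHb]].
  by split => //= f M _ fM; rewrite expr0 mul1r.
have slice_int (f : 'rV[R]_d.+1 -> R) : bucont f ->
    (@lebesgue_measure R).-integrable `[0, 2 * pi] (EFin \o
      (fun t => torus_integral
        (fun x : 'rV[R]_d => f (row_mx (t%:M : 'rV[R]_1) x)))).
  move=> bf; apply: unif_integrable => e e0.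
  have K0 : 0 < (2 * pi) ^+ d :> R by rewrite exprn_gt0// mulr_gt0// pi_gt0.
  have eK : 0 < e / (2 * pi) ^+ d by rewrite divr_gt0.
  have [a a0 fa] := bf.2 _ eK; exists a => // s t st.
  have bd := bucontD (bucont_slice s bf) (bucontZ (-1) (bucont_slice t bf)).
  rewrite -mulN1r -IHZ; last exact: bucont_slice.
  rewrite -IHD; [|exact: bucont_slice|exact/bucontZ/bucont_slice].
  have := IHb _ (e / (2 * pi) ^+ d) bd.
  rewrite mulrCA divff ?mulr1; last by rewrite gt_eqF.
  apply => x; rewrite mulN1r; apply: fa => i.
  case: (unliftP ord0 i) => [j ->|->].
    by rewrite !row_consS subrr normr0 ltW.
  by rewrite !row_cons0.
split => /=.
- move=> f g bf bg; rewrite -RintegralD//; [|exact: slice_int..].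
  by congr Rintegral; apply/funext => t; rewrite IHD//; exact: bucont_slice.
- move=> c f bf; rewrite -RintegralZl//; last exact: slice_int.
  by congr Rintegral; apply/funext => t; rewrite IHZ//; exact: bucont_slice.
- move=> f M bf fM; rewrite exprS -mulrA; apply: Rintegral_period_le.
    exact: slice_int.
  by move=> t; apply: IHb => //; exact: bucont_slice.
Qed.

(** For m <> 0 the primitive sin (m t + a) / m takes equal values at 0 and
2 pi, since m is an integer. *)
Lemma Rintegral_cos (R : realType) (m : int) (a : R) :
  \int[@lebesgue_measure R]_(t in `[0, 2 * pi]) cos (m%:~R * t + a) =
  if m == 0 then 2 * pi * cos a else 0.
Proof.
case: eqP => [->|/eqP m0].
  under [X in Rintegral _ _ X]eq_fun do rewrite mul0r add0r.
  by rewrite Rintegral_cst// measure_period mulrC.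
have mR0 : m%:~R != 0 :> R by rewrite intr_eq0.
have p0 : 0 < 2 * pi :> R by rewrite mulr_gt0// pi_gt0.
pose F (t : R) : R := m%:~R^-1 * sin (m%:~R * t + a).
have dF (t : R) : is_derive t 1 F (cos (m%:~R * t + a)).
  have -> : cos (m%:~R * t + a) = m%:~R^-1 * (m%:~R * cos (m%:~R * t + a)).
    by rewrite mulrA mulVf// mul1r.
  rewrite /F.
  apply: is_derive_eq.
  by rewrite /GRing.scale/= ?addr0 !mulr1 ?mulr0 ?add0r ?addr0 (mulrC (cos _)).
have cF : continuous F.
  move=> t; apply: differentiable_continuous; apply/derivable1_diffP.
  by case: (dF t).
rewrite /Rintegral (@continuous_FTC2 _ _ F)//.
- rewrite /F mulr0 add0r.
  suff -> : sin (m%:~R * (2 * pi) + a) = sin a by rewrite -EFinB subrr.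
  have sp (k : nat) (b : R) : sin (b + k%:R * (2 * pi)) = sin b.
    elim: k b => [|k IH] b; first by rewrite mul0r addr0.
    rewrite -[RHS](IH b) -[RHS]sinD2pi; congr sin.
    by rewrite -natr1; ring.
  case: m {m0 mR0 F dF cF} => k; first by rewrite addrC; exact: sp.
  by rewrite NegzE -(sp k.+1) mulrNz mulNr addrAC addNr add0r.
- apply: continuous_subspaceT => t.
  apply: differentiable_continuous; apply/derivable1_diffP.
  exact: ex_derive.
- split => [t _||]; first by case: (dF t).
  + by apply: cvg_at_right_filter; exact: cF.
  + by apply: cvg_at_left_filter; exact: cF.
- by move=> t _; rewrite derive1E; case: (dF t).
Qed.

(** Orthogonality of the characters.  The phase a makes the induction on the
dimension work, as the first variable becomes part of the phase of the inner
integral; a = - pi / 2 gives the sine. *)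
Lemma torus_integral_cos (R : realType) (d : nat) (m : 'rV[int]_d) (a : R) :
  torus_integral (fun x => cos (dot (map_mx intr m) x + a)) =
  if m == 0 then (2 * pi) ^+ d * cos a else 0.
Proof.
elim: d m a => [|d IH] m a.
  by rewrite /= expr0 mul1r /dot big_ord0 add0r thinmx0 eqxx.
pose m0 := m 0 ord0; pose m' : 'rV_d := \row_i m 0 (lift ord0 i).
have E (t : R) (x : 'rV[R]_d) :
    cos (dot (map_mx intr m) (row_mx (t%:M : 'rV[R]_1) x : 'rV[R]_d.+1) + a) =
    cos (dot (map_mx intr m') x + (m0%:~R * t + a)).
  rewrite {1}/dot big_ord_recl row_cons0 mxE -/m0 addrC addrA addrC.
  congr (cos (_ + _)); last by rewrite addrC.
  by apply: eq_bigr => i _; rewrite row_consS !mxE.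
rewrite /=.
under [X in Rintegral _ _ X]eq_fun => t.
  under [X in torus_integral X]eq_fun do rewrite E.
  rewrite IH; over.
have -> : (m == 0) = (m0 == 0) && (m' == 0).
  apply/eqP/andP => [m_0|[/eqP h /eqP h']].
    by rewrite /m0 /m' m_0 mxE; split=> //; apply/eqP/rowP => i; rewrite !mxE.
  apply/rowP => i; rewrite mxE; case: (unliftP ord0 i) => [j ->|->//].
  by move/rowP/(_ j): h'; rewrite !mxE.
case: (m' == 0); last first.
  by rewrite andbF Rintegral_cst ?mul0r.
have cu : (@lebesgue_measure R).-integrable `[0, 2 * pi]
    (EFin \o (fun t => cos ((m0)%:~R * t + a))).
  apply: unif_integrable => e e0.
  set S := `|(m0)%:~R : R| + 1.
  have S0 : 0 < S by rewrite /S ltr_wpDl.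
  exists (e / S); first by rewrite divr_gt0.
  move=> x y xy; apply: (le_trans (cos_lipschitz _ _)).
  rewrite opprD addrACA subrr addr0 -mulrBr normrM.
  apply: (@le_trans _ _ (S * (e / S))); first by rewrite ler_pM// /S lerDl.
  by rewrite mulrCA divff ?mulr1// gt_eqF.
rewrite andbT RintegralZl// Rintegral_cos.
by case: eqP => _; [rewrite exprS; ring|rewrite mulr0].
Qed.

(** * Complex-valued functions and the characters of the torus *)

Local Notation Re := complex.Re.
Local Notation Im := complex.Im.
Local Notation normc := Normc.normc.
Local Open Scope complex_scope.

Lemma complex_ext (R : realType) (x y : R[i]) :
  Re x = Re y -> Im x = Im y -> x = y.
Proof. by case: x => a b; case: y => c e /= -> ->. Qed.

Lemma ReD (R : realType) (x y : R[i]) : Re (x + y) = Re x + Re y.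
Proof. by case: x; case: y. Qed.

Lemma ImD (R : realType) (x y : R[i]) : Im (x + y) = Im x + Im y.
Proof. by case: x; case: y. Qed.

Lemma ReM (R : realType) (x y : R[i]) :
  Re (x * y) = Re x * Re y - Im x * Im y.
Proof. by case: x; case: y. Qed.

Lemma ImM (R : realType) (x y : R[i]) :
  Im (x * y) = Re x * Im y + Im x * Re y.
Proof. by case: x; case: y. Qed.

Lemma normcE (R : realType) (z : R[i]) :
  normc z = Num.sqrt (Re z ^+ 2 + Im z ^+ 2).
Proof. by case: z. Qed.

Lemma normc_ge0 (R : realType) (z : R[i]) : 0 <= normc z.
Proof. by rewrite normcE sqrtr_ge0. Qed.

Lemma normcJ (R : realType) (z : R[i]) : normc (conjc z) = normc z.
Proof. by case: z => a b /=; rewrite sqrrN. Qed.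

Lemma normcR (R : realType) (a : R) : normc a%:C = `|a|.
Proof. by rewrite normcE /= expr0n addr0 sqrtr_sqr. Qed.

Lemma normc_i (R : realType) : normc (0 +i* 1 : R[i]) = 1.
Proof. by rewrite /= expr0n expr1n add0r sqrtr1. Qed.

Lemma normc_Re (R : realType) (z : R[i]) : `|Re z| <= normc z.
Proof. by rewrite normcE -sqrtr_sqr ler_wsqrtr// lerDl sqr_ge0. Qed.

Lemma normc_Im (R : realType) (z : R[i]) : `|Im z| <= normc z.
Proof. by rewrite normcE -sqrtr_sqr ler_wsqrtr// lerDr sqr_ge0. Qed.

Lemma normc_le (R : realType) (z : R[i]) : normc z <= `|Re z| + `|Im z|.
Proof.
rewrite normcE -[leRHS]ger0_norm ?addr_ge0// -sqrtr_sqr ler_wsqrtr//.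
rewrite sqrrD !real_normK ?num_real// lerD2r lerDl.
by rewrite mulrn_wge0// mulr_ge0.
Qed.

Lemma normc_sum (R : realType) (I : Type) (s : seq I) (P : pred I)
    (f : I -> R[i]) :
  normc (\sum_(i <- s | P i) f i) <= \sum_(i <- s | P i) normc (f i).
Proof.
elim/big_ind2: _ => // [|x a y b xa yb]; first by rewrite Normc.normc0.
by rewrite (le_trans (le_normcD _ _))// lerD.
Qed.

(** Stated on real and imaginary parts because the integral over the torus is
defined on real functions only. *)
Definition cbucont (R : realType) (d : nat) (f : 'rV[R]_d -> R[i]) : Prop :=
  bucont (fun x => Re (f x)) /\ bucont (fun x => Im (f x)).

Lemma cbucont_cst (R : realType) (d : nat) (c : R[i]) :
  cbucont (fun _ : 'rV[R]_d => c).
Proof. by split; exact: bucont_cst. Qed.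

Lemma cbucontD (R : realType) (d : nat) (f g : 'rV[R]_d -> R[i]) :
  cbucont f -> cbucont g -> cbucont (fun x => f x + g x).
Proof.
move=> [f1 f2] [g1 g2]; split.
  by move: (bucontD f1 g1); congr bucont; apply/funext => x; rewrite ReD.
by move: (bucontD f2 g2); congr bucont; apply/funext => x; rewrite ImD.
Qed.

Lemma cbucontM (R : realType) (d : nat) (f g : 'rV[R]_d -> R[i]) :
  cbucont f -> cbucont g -> cbucont (fun x => f x * g x).
Proof.
move=> [f1 f2] [g1 g2]; split.
  move: (bucontD (bucontM f1 g1) (bucontN (bucontM f2 g2))).
  by congr bucont; apply/funext => x; rewrite ReM.
move: (bucontD (bucontM f1 g2) (bucontM f2 g1)).
by congr bucont; apply/funext => x; rewrite ImM.
Qed.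

Lemma cbucont_sum (R : realType) (d : nat) (I : Type) (s : seq I) (P : pred I)
    (f : I -> 'rV[R]_d -> R[i]) :
  (forall i, cbucont (f i)) -> cbucont (fun x => \sum_(i <- s | P i) f i x).
Proof.
move=> bf; elim: s => [|i s IH].
  rewrite (_ : (fun _ => _) = fun=> 0); first exact: cbucont_cst.
  by apply/funext => x; rewrite big_nil.
case Pi : (P i); last first.
  by move: IH; congr cbucont; apply/funext => x; rewrite big_cons Pi.
move: (cbucontD (bf i) IH); congr cbucont; apply/funext => x.
by rewrite big_cons Pi.
Qed.

Lemma cbucont_lim (R : realType) (d : nat) (f : 'rV[R]_d -> R[i]) :
  (forall e : R, 0 < e ->
    exists2 g, cbucont g & forall x, normc (f x - g x) <= e) ->
  cbucont f.
Proof.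
move=> fg; split; apply: bucont_lim => e /fg[g [g1 g2] H].
  exists (fun x => Re (g x)) => // x; apply: le_trans (H x).
  by rewrite (le_trans _ (normc_Re _))// ReD; case: (g x).
exists (fun x => Im (g x)) => // x; apply: le_trans (H x).
by rewrite (le_trans _ (normc_Im _))// ImD; case: (g x).
Qed.

(** The Fourier coefficient of index k of f is by definition the value of this
integral at conj (e_k) f. *)
Definition cintegral (R : realType) (d : nat) (f : 'rV[R]_d -> R[i]) : R[i] :=
  torus_integral (fun x => Re (f x)) +i* torus_integral (fun x => Im (f x)).

Lemma torusD (R : realType) (d : nat) (f g : 'rV[R]_d -> R) :
  bucont f -> bucont g ->
  torus_integral (fun x => f x + g x) = torus_integral f + torus_integral g.
Proof. by have [H _ _] := torus_integral_unif R d; exact: H. Qed.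

Lemma torusZ (R : realType) (d : nat) (c : R) (f : 'rV[R]_d -> R) :
  bucont f -> torus_integral (fun x => c * f x) = c * torus_integral f.
Proof. by have [_ H _] := torus_integral_unif R d; exact: H. Qed.

Lemma cintegralD (R : realType) (d : nat) (f g : 'rV[R]_d -> R[i]) :
  cbucont f -> cbucont g ->
  cintegral (fun x => f x + g x) = cintegral f + cintegral g.
Proof.
move=> [f1 f2] [g1 g2]; apply: complex_ext; rewrite ?ReD ?ImD /=.
  by rewrite -torusD//; congr torus_integral; apply/funext => x; rewrite ReD.
by rewrite -torusD//; congr torus_integral; apply/funext => x; rewrite ImD.
Qed.

Lemma cintegralZ (R : realType) (d : nat) (c : R[i]) (f : 'rV[R]_d -> R[i]) :
  cbucont f -> cintegral (fun x => c * f x) = c * cintegral f.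
Proof.
move=> [f1 f2]; apply: complex_ext; rewrite ?ReM ?ImM /=.
  rewrite -mulNr -!torusZ// -torusD; [|exact: bucontZ..].
  by congr torus_integral; apply/funext => x; rewrite ReM mulNr.
rewrite -!torusZ// -torusD; [|exact: bucontZ..].
by congr torus_integral; apply/funext => x; rewrite ImM.
Qed.

Lemma cintegral_sum (R : realType) (d : nat) (I : Type) (s : seq I)
    (f : I -> 'rV[R]_d -> R[i]) :
  (forall i, cbucont (f i)) ->
  cintegral (fun x => \sum_(i <- s) f i x) = \sum_(i <- s) cintegral (f i).
Proof.
move=> bf; elim: s => [|i s IH].
  rewrite big_nil (_ : (fun _ => _) = fun x : 'rV[R]_d => 0 * (0 : R[i])).
    by rewrite cintegralZ ?mul0r//; exact: cbucont_cst.
  by apply/funext => x; rewrite big_nil mul0r.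
rewrite big_cons -IH -cintegralD//; last exact: cbucont_sum.
by congr cintegral; apply/funext => x; rewrite big_cons.
Qed.

Lemma cintegral_le (R : realType) (d : nat) (f : 'rV[R]_d -> R[i]) (M : R) :
  cbucont f -> (forall x, normc (f x) <= M) ->
  normc (cintegral f) <= 2 * (2 * pi) ^+ d * M.
Proof.
move=> [f1 f2] fM; apply: (le_trans (normc_le _)).
have [_ _ H] := torus_integral_unif R d.
rewrite -mulrA mulr_natl mulr2n lerD//; apply: H => // x.
  exact: le_trans (normc_Re _) (fM x).
exact: le_trans (normc_Im _) (fM x).
Qed.

Definition expi (R : realType) (t : R) : R[i] := cos t +i* sin t.

Lemma expiD (R : realType) (s t : R) : expi (s + t) = expi s * expi t.
Proof.
by apply: complex_ext; rewrite ?ReM ?ImM /= ?cosD ?sinD// addrC.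
Qed.

Lemma expiN (R : realType) (t : R) : expi (- t) = conjc (expi t).
Proof. by rewrite /expi cosN sinN. Qed.

Lemma normc_expi (R : realType) (t : R) : normc (expi t) = 1.
Proof. by rewrite normcE /= cos2Dsin2 sqrtr1. Qed.

Definition e_coef (R : realType) (d : nat) : R := (2 * pi) `^ (- (d%:R / 2)).

Lemma e_coef_gt0 (R : realType) (d : nat) : 0 < e_coef R d.
Proof. by rewrite powR_gt0// mulr_gt0// pi_gt0. Qed.

(** This is the normalization that makes the e_k orthonormal. *)
Lemma e_coef_sqr (R : realType) (d : nat) : e_coef R d ^+ 2 * (2 * pi) ^+ d = 1.
Proof.
have p0 : 0 < 2 * pi :> R by rewrite mulr_gt0// pi_gt0.
rewrite -powR_mulrn ?ltW ?e_coef_gt0// /e_coef -powRrM.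
rewrite -[(2 * pi) ^+ d]powR_mulrn ?ltW//.
rewrite -powRD; last by rewrite (gt_eqF p0) implybT.
by rewrite mulNr divfK// addNr powRr0.
Qed.

Lemma e_E (R : realType) (d : nat) (k : 'rV[int]_d) (x : 'rV[R]_d) :
  e_ k x = (e_coef R d)%:C * expi (dot (map_mx intr k) x).
Proof. by []. Qed.

Lemma normc_e (R : realType) (d : nat) (k : 'rV[int]_d) (x : 'rV[R]_d) :
  normc (e_ k x) = e_coef R d.
Proof.
by rewrite e_E Normc.normcM normc_expi mulr1 normcR gtr0_norm ?e_coef_gt0.
Qed.

Lemma cbucont_expi (R : realType) (d : nat) (m : 'rV[R]_d) :
  cbucont (fun x => expi (dot m x)).
Proof.
split => /=.
  move: (bucont_cos m 0); congr bucont; apply/funext => x; by rewrite addr0.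
move: (bucont_cos m (- (pi / 2))); congr bucont; apply/funext => x.
by rewrite cosBpihalf.
Qed.

Lemma cbucont_e (R : realType) (d : nat) (k : 'rV[int]_d) :
  cbucont (fun x : 'rV[R]_d => e_ k x).
Proof. by apply: cbucontM; [exact: cbucont_cst|exact: cbucont_expi]. Qed.

Lemma cbucont_conj (R : realType) (d : nat) (f : 'rV[R]_d -> R[i]) :
  cbucont f -> cbucont (fun x => conjc (f x)).
Proof.
move=> [f1 f2]; split.
  by move: f1; congr bucont; apply/funext => x; case: (f x).
by move: (bucontN f2); congr bucont; apply/funext => x; case: (f x).
Qed.

Lemma cintegral_expi (R : realType) (d : nat) (m : 'rV[int]_d) :
  cintegral (fun x : 'rV[R]_d => expi (dot (map_mx intr m) x)) =
  if m == 0 then ((2 * pi) ^+ d)%:C else 0.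
Proof.
have H1 := @torus_integral_cos R d m 0.
have H2 := @torus_integral_cos R d m (- (pi / 2)).
rewrite /cintegral /=.
rewrite (_ : (fun x => cos _) =
    (fun x => cos (dot (map_mx intr m) x + 0))); last first.
  by apply/funext => x; rewrite addr0.
rewrite (_ : (fun x => sin _) =
    (fun x => cos (dot (map_mx intr m) x + - (pi / 2)))); last first.
  by apply/funext => x; rewrite cosBpihalf.
rewrite H1 H2 cos0 cosN cos_pihalf mulr1 mulr0.
by case: eqP.
Qed.

(** The integrand is a constant times the character of index h + l - k.  Three
factors e_coef come from the three characters and two of them cancel against the
volume of the torus. *)
Lemma cintegral_e (R : realType) (d : nat) (k h l : 'rV[int]_d) :
  cintegral (fun x : 'rV[R]_d => conjc (e_ k x) * (e_ h x * e_ l x)) =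
  if h + l == k then (e_coef R d)%:C else 0.
Proof.
rewrite (_ : (fun _ => _) = fun x : 'rV[R]_d =>
    (e_coef R d ^+ 3)%:C * expi (dot (map_mx intr (h + l - k)) x)).
  rewrite cintegralZ ?cintegral_expi ?subr_eq0; last exact: cbucont_expi.
  case: eqP => _; last by rewrite mulr0.
  by rewrite -rmorphM/= exprS -mulrA e_coef_sqr mulr1.
apply/funext => x; rewrite !e_E.
have -> : conjc ((e_coef R d)%:C * expi (dot (map_mx intr k) x)) =
    (e_coef R d)%:C * expi (- dot (map_mx intr k) x).
  by rewrite expiN; apply: complex_ext => /=; ring.
have -> : dot (map_mx intr (h + l - k)) x = - dot (map_mx intr k) x +
    (dot (map_mx intr h) x + dot (map_mx intr l) x).
  rewrite /dot -sumrN -!big_split /=; apply: eq_bigr => r _.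
  by rewrite !mxE !rmorphD/= rmorphN/=; ring.
by rewrite !expiD !rmorphXn/=; ring.
Qed.

(** * Fourier coefficients of a product of absolutely convergent series *)

Lemma sum_subset_le (R : realDomainType) (I : eqType) (f : I -> R)
    (s t : seq I) :
  (forall i, 0 <= f i) -> uniq s -> uniq t -> {subset s <= t} ->
  \sum_(i <- s) f i <= \sum_(i <- t) f i.
Proof.
move=> f0 us ut st; rewrite [leRHS](bigID [in s]) /=.
apply: ler_wpDr; first exact: sumr_ge0.
rewrite -[leRHS]big_filter (perm_big [seq i <- t | i \in s])//.
apply: uniq_perm => //; first by rewrite filter_uniq.
by move=> i; rewrite mem_filter; case: (boolP (i \in s)) => // /st ->.
Qed.

(** T is a sequence that nearly attains the supremum of the finite sums: what
can still be added outside T is at most the defect. *)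
Lemma sumle_tail (R : realType) (I : choiceType) (f : I -> R) (M : R) :
  (forall s : seq I, uniq s -> \sum_(i <- s) f i <= M) ->
  forall e : R, 0 < e -> exists2 T : seq I, uniq T &
    forall s, uniq s -> (forall i, i \in s -> i \notin T) ->
      \sum_(i <- s) f i <= e.
Proof.
move=> fM e e0.
pose E := [set x : R | exists2 s : seq I, uniq s & x = \sum_(i <- s) f i].
have hE : has_sup E.
  split; first by exists 0, [::] => //; rewrite big_nil.
  by exists M => _ [s us ->]; exact: fM.
have [_ [T uT ->] hT] := sup_adherent e0 hE.
exists T => // s us sT.
have : \sum_(i <- T ++ s) f i <= sup E.
  apply: ub_le_sup; first exact: hE.2.
  exists (T ++ s) => //; rewrite cat_uniq uT us andbT /=.
  by apply/hasPn.
by move: hT; rewrite big_cat /=; lra.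
Qed.

Lemma esum_le_seq (R : realType) (I : choiceType) (D : set I) (f : I -> R)
    (M : R) :
  (forall s : seq I, uniq s -> (forall i, i \in s -> D i) ->
     \sum_(i <- s) f i <= M) ->
  (\esum_(i in D) (f i)%:E <= M%:E)%E.
Proof.
move=> fM; apply: ge_ereal_sup => _ [X [finX XD] <-].
rewrite fsbig_finite//= sumEFin lee_fin; apply: fM => // i.
by rewrite in_fset_set// inE => /XD.
Qed.

Lemma esum_ge_seq (R : realType) (I : choiceType) (D : set I) (f : I -> R)
    (s : seq I) :
  uniq s -> (forall i, i \in s -> D i) ->
  ((\sum_(i <- s) f i)%:E <= \esum_(i in D) (f i)%:E)%E.
Proof.
move=> us sD; apply: esum_ge; exists [set` s].
  by split => //; exact: finite_seq.
by rewrite -sumEFin fsbig_seq.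
Qed.

(** The sum of h lies between its sum over T and this plus the mass of g
outside T.  The tail bound is on a majorant g so that one T serves for a whole
family of functions h, such as the values of a Fourier series at all points. *)
Lemma esum_approx (R : realType) (I : choiceType) (h g : I -> R) (T : seq I)
    (e : R) :
  uniq T -> (forall i, 0 <= h i <= g i) ->
  (forall s, uniq s -> (forall i, i \in s -> i \notin T) ->
      \sum_(i <- s) g i <= e) ->
  `|fine (\esum_(i in [set: I]) (h i)%:E) - \sum_(i <- T) h i| <= e.
Proof.
move=> uT hg gT.
have h0 i : 0 <= h i by case/andP: (hg i).
have e0 : 0 <= e by have := gT [::] isT; rewrite big_nil; apply.
have lo : ((\sum_(i <- T) h i)%:E <= \esum_(i in [set: I]) (h i)%:E)%E.
  exact: esum_ge_seq.
have up : (\esum_(i in [set: I]) (h i)%:E <= (\sum_(i <- T) h i + e)%:E)%E.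
  apply: esum_le_seq => s us _.
  rewrite (bigID [in T]) /= lerD//.
    rewrite -big_filter; apply: sum_subset_le => //.
      by rewrite filter_uniq.
    by move=> i; rewrite mem_filter => /andP[].
  apply: (@le_trans _ _ (\sum_(i <- s | i \notin T) g i)).
    by apply: ler_sum => i _; case/andP: (hg i).
  rewrite -big_filter; apply: gT; first by rewrite filter_uniq.
  by move=> i; rewrite mem_filter => /andP[].
move: lo up; case: (esum _ _) => [x| |] //=.
by rewrite !lee_fin => lo up; rewrite ger0_norm ?subr_ge0// lerBlDl.
Qed.

Lemma rsum_approx (R : realType) (I : choiceType) (f g : I -> R) (T : seq I)
    (e : R) :
  uniq T -> (forall i, `|f i| <= g i) ->
  (forall s, uniq s -> (forall i, i \in s -> i \notin T) ->
      \sum_(i <- s) g i <= e) ->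
  `|rsum f - \sum_(i <- T) f i| <= 2 * e.
Proof.
move=> uT fg gT; rewrite /rsum.
have hp i : 0 <= Num.max (f i) 0 <= g i.
  rewrite le_max lexx orbT /= ge_max (le_trans (ler_norm _) (fg i)).
  exact: le_trans (fg i).
have hn i : 0 <= Num.max (- f i) 0 <= g i.
  rewrite le_max lexx orbT /= ge_max; apply/andP; split.
    by apply: le_trans (fg i); rewrite -normrN ler_norm.
  exact: le_trans (fg i).
have Hp := esum_approx uT hp gT; have Hn := esum_approx uT hn gT.
have -> : \sum_(i <- T) f i =
    \sum_(i <- T) Num.max (f i) 0 - \sum_(i <- T) Num.max (- f i) 0.
  rewrite -sumrB; apply: eq_bigr => i _; rewrite /Num.max.
  by case: ifPn; case: ifPn; rewrite ?oppr_lt0 ?oppr_gt0; lra.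
set u := fine _; set w := fine _ in Hn *; set p := \sum_(i <- T) _.
set q := \sum_(i <- T) _.
have -> : u - w - (p - q) = (u - p) - (w - q) by ring.
by rewrite mulr_natl mulr2n (le_trans (ler_normB _ _))// lerD.
Qed.

Lemma csum_approx (R : realType) (I : choiceType) (f : I -> R[i]) (g : I -> R)
    (T : seq I) (e : R) :
  uniq T -> (forall i, normc (f i) <= g i) ->
  (forall s, uniq s -> (forall i, i \in s -> i \notin T) ->
      \sum_(i <- s) g i <= e) ->
  normc (csum f - \sum_(i <- T) f i) <= 4 * e.
Proof.
move=> uT fg gT; apply: (le_trans (normc_le _)).
have -> : 4 * e = 2 * e + 2 * e by ring.
have ReS : Re (\sum_(i <- T) f i) = \sum_(i <- T) Re (f i).
  by elim: T {uT gT} => [|i T IH]; rewrite ?big_nil// !big_cons ReD IH.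
have ImS : Im (\sum_(i <- T) f i) = \sum_(i <- T) Im (f i).
  by elim: T {uT gT ReS} => [|i T IH]; rewrite ?big_nil// !big_cons ImD IH.
rewrite lerD//.
  have -> : Re (csum f - \sum_(i <- T) f i) =
      rsum (fun i => Re (f i)) - \sum_(i <- T) Re (f i).
    by rewrite -ReS; case: (\sum_(i <- T) f i).
  by apply: (rsum_approx (g := g)) => // i; apply: le_trans (normc_Re _) _.
have -> : Im (csum f - \sum_(i <- T) f i) =
    rsum (fun i => Im (f i)) - \sum_(i <- T) Im (f i).
  by rewrite -ImS; case: (\sum_(i <- T) f i).
by apply: (rsum_approx (g := g)) => // i; apply: le_trans (normc_Im _) _.
Qed.

Definition trig_sum (R : realType) (d : nat) (a : dist R d) (T : seq 'rV[int]_d)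
  (x : 'rV[R]_d) : R[i] := \sum_(h <- T) a h * e_ h x.

Lemma cbucont_trig_sum (R : realType) (d : nat) (a : dist R d)
    (T : seq 'rV[int]_d) :
  cbucont (trig_sum a T).
Proof.
apply: cbucont_sum => h.
by apply: cbucontM; [exact: cbucont_cst|exact: cbucont_e].
Qed.

(** The bound does not depend on x, since every character has modulus e_coef:
the convergence is uniform on the torus. *)
Lemma tofun_approx (R : realType) (d : nat) (a : dist R d)
    (T : seq 'rV[int]_d) (e : R) (x : 'rV[R]_d) :
  uniq T ->
  (forall s, uniq s -> (forall i, i \in s -> i \notin T) ->
      \sum_(i <- s) normc (a i) <= e) ->
  normc (tofun a x - trig_sum a T x) <= 4 * e_coef R d * e.
Proof.
move=> uT aT; rewrite -mulrA.
apply: (csum_approx (g := fun k => e_coef R d * normc (a k))) => //.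
  by move=> k; rewrite Normc.normcM normc_e mulrC.
move=> s us sT; rewrite -mulr_sumr ler_pM2l ?e_coef_gt0//; exact: aT.
Qed.

Lemma cbucont_tofun (R : realType) (d : nat) (a : dist R d) (A : R) :
  (forall s : seq 'rV[int]_d, uniq s -> \sum_(h <- s) normc (a h) <= A) ->
  cbucont (tofun a).
Proof.
move=> aA; apply: cbucont_lim => e e0.
have c0 : 0 < 4 * e_coef R d by rewrite mulr_gt0 ?e_coef_gt0.
have [T uT aT] := sumle_tail aA (divr_gt0 e0 c0).
exists (trig_sum a T); first exact: cbucont_trig_sum.
move=> x; apply: (le_trans (tofun_approx x uT aT)).
by rewrite mulrCA divff ?mulr1// gt_eqF.
Qed.

Lemma normc_trig_sum (R : realType) (d : nat) (a : dist R d) (A : R)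
    (T : seq 'rV[int]_d) (x : 'rV[R]_d) :
  \sum_(h <- T) normc (a h) <= A -> normc (trig_sum a T x) <= e_coef R d * A.
Proof.
move=> aA; apply: (le_trans (normc_sum _ _ _)).
under eq_bigr do rewrite Normc.normcM normc_e mulrC.
by rewrite -mulr_sumr ler_pM2l ?e_coef_gt0.
Qed.

(** The k-th coefficient of the product of two partial sums over the same
frequencies T, without the normalization constant. *)
Definition trunc_conv (R : realType) (d : nat) (a b : dist R d)
  (T : seq 'rV[int]_d) (k : 'rV[int]_d) : R[i] :=
  \sum_(h <- T) \sum_(l <- T) if h + l == k then a h * b l else 0.

Lemma fourier_trig_sum (R : realType) (d : nat) (a b : dist R d)
    (T : seq 'rV[int]_d) (k : 'rV[int]_d) :
  fourier (fun x => trig_sum a T x * trig_sum b T x) k =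
  (e_coef R d)%:C * trunc_conv a b T k.
Proof.
rewrite -[LHS]/(cintegral (fun x =>
  conjc (e_ k x) * (trig_sum a T x * trig_sum b T x))).
have cb h l : cbucont (fun x : 'rV[R]_d => conjc (e_ k x) * (e_ h x * e_ l x)).
  apply: cbucontM; first exact/cbucont_conj/cbucont_e.
  by apply: cbucontM; exact: cbucont_e.
rewrite (_ : (fun _ => _) = fun x : 'rV[R]_d => \sum_(h <- T) \sum_(l <- T)
    (a h * b l) * (conjc (e_ k x) * (e_ h x * e_ l x))).
  rewrite cintegral_sum => [|h]; last first.
    by apply: cbucont_sum => l; apply: cbucontM; [exact: cbucont_cst|exact: cb].
  rewrite /trunc_conv mulr_sumr; apply: eq_bigr => h _.
  rewrite cintegral_sum => [|l]; last first.
    by apply: cbucontM; [exact: cbucont_cst|exact: cb].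
  rewrite mulr_sumr; apply: eq_bigr => l _.
  by rewrite cintegralZ// cintegral_e; case: eqP => _; rewrite ?mulr0// mulrC.
apply/funext => x; rewrite /trig_sum mulr_suml mulr_sumr; apply: eq_bigr => h _.
by rewrite !mulr_sumr; apply: eq_bigr => l _; ring.
Qed.

Lemma cbucontN (R : realType) (d : nat) (f : 'rV[R]_d -> R[i]) :
  cbucont f -> cbucont (fun x => -1 * f x).
Proof. by apply: cbucontM; exact: cbucont_cst. Qed.

(** The coefficient depends continuously on the two factors for uniform
convergence, and T can be enlarged at will; the prescribed frequencies T0 allow
all nonzero terms of a finitely supported convolution to be included. *)
Lemma fourier_prod_approx (R : realType) (d : nat) (a b : dist R d) (A B : R)
    (T0 : seq 'rV[int]_d) (k : 'rV[int]_d) (e : R) :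
  (forall s : seq 'rV[int]_d, uniq s -> \sum_(h <- s) normc (a h) <= A) ->
  (forall s : seq 'rV[int]_d, uniq s -> \sum_(h <- s) normc (b h) <= B) ->
  0 < e ->
  exists T, [/\ uniq T, {subset T0 <= T} &
    normc (fourier (fun x => tofun a x * tofun b x) k
           - (e_coef R d)%:C * trunc_conv a b T k) <= e].
Proof.
move=> aA bB e0; set c := e_coef R d.
have c0 : 0 < c := e_coef_gt0 R d.
have A0 : 0 <= A by have := aA [::] isT; rewrite big_nil.
have B0 : 0 <= B by have := bB [::] isT; rewrite big_nil.
have p0 : 0 < (2 * pi) ^+ d :> R by rewrite exprn_gt0// mulr_gt0// pi_gt0.
(* bound for the variation of the coefficient per unit of l^1 error: volume,
   character, and the two terms of the difference of the products *)
set K := 2 * (2 * pi) ^+ d * c * (4 * c) * c * (A + B + 4).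
have K0 : 0 < K by rewrite !mulr_gt0// ltr_wpDl// addr_ge0.
set e' := Num.min 1 (e / K).
have e'0 : 0 < e' by rewrite lt_min ltr01 divr_gt0.
have e'1 : e' <= 1 by rewrite ge_min lexx.
have e'K : K * e' <= e.
  by rewrite mulrC -ler_pdivlMr// ge_min lexx orbT.
have [Ta uTa aTa] := sumle_tail aA e'0; have [Tb uTb bTb] := sumle_tail bB e'0.
set T := undup (T0 ++ Ta ++ Tb).
have uT : uniq T by exact: undup_uniq.
have aT s : uniq s -> (forall i, i \in s -> i \notin T) ->
    \sum_(i <- s) normc (a i) <= e'.
  move=> us sT; apply: aTa => // i /sT.
  by rewrite mem_undup !mem_cat !negb_or => /and3P[].
have bT s : uniq s -> (forall i, i \in s -> i \notin T) ->
    \sum_(i <- s) normc (b i) <= e'.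
  move=> us sT; apply: bTb => // i /sT.
  by rewrite mem_undup !mem_cat !negb_or => /and3P[].
exists T; split => //; first by move=> h; rewrite mem_undup mem_cat => ->.
have ca := cbucont_tofun aA; have cb := cbucont_tofun bB.
have ce : cbucont (fun x : 'rV[R]_d => conjc (e_ k x)).
  exact/cbucont_conj/cbucont_e.
rewrite -/c -fourier_trig_sum.
rewrite -[fourier _ _]/(cintegral (fun x =>
  conjc (e_ k x) * (tofun a x * tofun b x))).
rewrite -[fourier _ _]/(cintegral (fun x =>
  conjc (e_ k x) * (trig_sum a T x * trig_sum b T x))).
have ct : cbucont (fun x => conjc (e_ k x) * (trig_sum a T x * trig_sum b T x)).
  by apply: cbucontM => //; apply: cbucontM; exact: cbucont_trig_sum.
have cf : cbucont (fun x => conjc (e_ k x) * (tofun a x * tofun b x)).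
  by apply: cbucontM => //; exact: cbucontM.
rewrite -mulN1r -cintegralZ// -cintegralD//; last exact: cbucontN.
apply: (@le_trans _ _ (2 * (2 * pi) ^+ d *
    (c * ((4 * c * e') * (c * (A + B + 4)))))); last first.
  apply: le_trans e'K; rewrite le_eqVlt; apply/orP; left; apply/eqP.
  by rewrite /K; ring.
apply: cintegral_le; first by apply: cbucontD => //; exact: cbucontN.
move=> x.
have -> : conjc (e_ k x) * (tofun a x * tofun b x) +
    -1 * (conjc (e_ k x) * (trig_sum a T x * trig_sum b T x)) =
    conjc (e_ k x) * ((tofun a x - trig_sum a T x) * tofun b x +
      (tofun b x - trig_sum b T x) * trig_sum a T x) by ring.
rewrite Normc.normcM normcJ normc_e -/c ler_pM2l//.
have da := tofun_approx x uT aT; have db := tofun_approx x uT bT.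
rewrite -/c in da db.
have ta := normc_trig_sum x (aA _ uT); have tb := normc_trig_sum x (bB _ uT).
rewrite -/c in ta tb.
have fb : normc (tofun b x) <= c * (B + 4).
  rewrite -(subrK (trig_sum b T x) (tofun b x)) (le_trans (le_normcD _ _))//.
  rewrite mulrDr addrC lerD//; apply: (le_trans db).
  by rewrite [leRHS]mulrC ler_piMr// mulr_ge0// ltW.
apply: (le_trans (le_normcD _ _)); rewrite !Normc.normcM.
have -> : A + B + 4 = (B + 4) + A by ring.
rewrite [c * _]mulrDr mulrDr lerD// ler_pM ?normc_ge0//.
Qed.

(** * Norms of vectors and frequencies; convolution inequalities *)

Definition fnorm (R : realType) (d : nat) (k : 'rV[int]_d) : R :=
  vnorm (toC R k).

Lemma vnorm_sqr (R : realType) (d : nat) (a : 'rV[R[i]]_d) :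
  vnorm a ^+ 2 = \sum_(r < d) normc (a 0 r) ^+ 2.
Proof.
have E : Re (dot (map_mx conjc a) a) = \sum_(r < d) normc (a 0 r) ^+ 2.
  rewrite /dot; elim/big_rec2: _ => // r x y _ <-.
  rewrite ReD mxE normcE sqr_sqrtr ?addr_ge0 ?sqr_ge0//.
  by case: (a 0 r) => u w /=; congr (_ + _); ring.
by rewrite /vnorm sqr_sqrtr E// sumr_ge0// => r _; rewrite sqr_ge0.
Qed.

Lemma vnorm_ge0 (R : realType) (d : nat) (a : 'rV[R[i]]_d) : 0 <= vnorm a.
Proof. exact: sqrtr_ge0. Qed.

Lemma vnorm0 (R : realType) (d : nat) : vnorm (0 : 'rV[R[i]]_d) = 0.
Proof.
apply/eqP; rewrite -sqrf_eq0 vnorm_sqr big1// => r _.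
by rewrite mxE Normc.normc0 expr0n.
Qed.

Lemma normc_vnorm (R : realType) (d : nat) (a : 'rV[R[i]]_d) (r : 'I_d) :
  normc (a 0 r) <= vnorm a.
Proof.
rewrite -(@ler_pXn2r _ 2)// ?nnegrE ?normc_ge0 ?vnorm_ge0// vnorm_sqr.
by rewrite (bigD1 r)//= lerDl sumr_ge0// => i _; rewrite sqr_ge0.
Qed.

Lemma sum_sqr_le (R : realDomainType) (I : Type) (s : seq I) (f : I -> R) :
  (forall i, 0 <= f i) ->
  \sum_(i <- s) f i ^+ 2 <= (\sum_(i <- s) f i) ^+ 2.
Proof.
move=> f0; elim: s => [|i s IH]; first by rewrite !big_nil expr0n.
rewrite !big_cons sqrrD; have : 0 <= f i * \sum_(j <- s) f j.
  by rewrite mulr_ge0// sumr_ge0.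
by move: IH; lra.
Qed.

Lemma vnorm_le_sum (R : realType) (d : nat) (a : 'rV[R[i]]_d) :
  vnorm a <= \sum_(r < d) normc (a 0 r).
Proof.
rewrite -(@ler_pXn2r _ 2)// ?nnegrE ?vnorm_ge0//; last first.
  by rewrite sumr_ge0// => r _; exact: normc_ge0.
by rewrite vnorm_sqr; apply: sum_sqr_le => r; exact: normc_ge0.
Qed.

Lemma normc_int (R : realType) (z : int) : normc (z%:~R : R[i]) = `|z%:~R|.
Proof.
have -> : (z%:~R : R[i]) = (z%:~R : R)%:C by rewrite rmorph_int.
exact: normcR.
Qed.

Lemma fnorm_ge0 (R : realType) (d : nat) (k : 'rV[int]_d) : 0 <= fnorm R k.
Proof. exact: vnorm_ge0. Qed.

Lemma fnorm_sqr (R : realType) (d : nat) (k : 'rV[int]_d) :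
  fnorm R k ^+ 2 = \sum_(r < d) ((k 0 r)%:~R) ^+ 2.
Proof.
rewrite /fnorm vnorm_sqr; apply: eq_bigr => r _.
by rewrite mxE normc_int real_normK// num_real.
Qed.

Lemma le_fnorm (R : realType) (d : nat) (k : 'rV[int]_d) (r : 'I_d) :
  `|(k 0 r)%:~R| <= fnorm R k.
Proof. by have := normc_vnorm (toC R k) r; rewrite mxE normc_int. Qed.

Lemma fnorm0 (R : realType) (d : nat) : fnorm R (0 : 'rV[int]_d) = 0.
Proof.
apply/eqP; rewrite -sqrf_eq0 fnorm_sqr big1// => r _.
by rewrite mxE mulr0z expr0n.
Qed.

Lemma fnorm_ge1 (R : realType) (d : nat) (k : 'rV[int]_d) :
  k != 0 -> 1 <= fnorm R k.
Proof.
move=> k0; have [r kr] : exists r, k 0 r != 0.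
  apply/existsP; apply: contra_neqT k0 => /existsPn H.
  by apply/rowP => r; rewrite mxE; apply/eqP; have := H r; rewrite negbK.
apply: le_trans (le_fnorm R k r); rewrite -intr_norm ler1z.
by rewrite -gtz0_ge1 normr_gt0.
Qed.

(** The hypothesis is the parallelogram inequality for z = |h + l|, x = |h|
and y = |l|.  It gives z <= 2 max (x, y), and the base 2 obtained here is the
limit in the final theorem. *)
Lemma max_powR_le (R : realType) (x y z p : R) :
  0 <= x -> 0 <= y -> 0 <= z -> z ^+ 2 <= 2 * x ^+ 2 + 2 * y ^+ 2 ->
  0 <= p -> z `^ p <= 2 `^ p * (x `^ p + y `^ p).
Proof.
wlog xy : x y / x <= y => [H x0 y0 z0 zxy p0|x0 y0 z0 zxy p0].
  have [|/ltW] := leP x y => xy; first exact: H.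
  by rewrite (addrC (x `^ p)); apply: H => //; rewrite addrC.
have zy : z <= 2 * y.
  rewrite -(@ler_pXn2r _ 2)// ?nnegrE ?mulr_ge0//.
  have : x ^+ 2 <= y ^+ 2 by rewrite ler_pXn2r.
  by rewrite exprMn; lra.
apply: (@le_trans _ _ ((2 * y) `^ p)).
  by rewrite ge0_ler_powR// ?nnegrE ?mulr_ge0.
by rewrite powRM// ler_wpM2l ?powR_ge0// lerDr powR_ge0.
Qed.

Lemma fnorm_add_powR (R : realType) (d : nat) (h l : 'rV[int]_d) (p : R) :
  0 <= p -> fnorm R (h + l) `^ p <= 2 `^ p * (fnorm R h `^ p + fnorm R l `^ p).
Proof.
apply: max_powR_le; [exact: fnorm_ge0..|].
rewrite !fnorm_sqr !mulr_sumr -big_split /=; apply: ler_sum => r _.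
rewrite mxE intrD; set a : R := _%:~R; set b : R := _%:~R.
have : 0 <= (a - b) ^+ 2 by rewrite sqr_ge0.
by lra.
Qed.

(** Lagrange's identity: the difference of the two sides is half the sum of
the squares (x_i y_j - x_j y_i)^2. *)
Lemma cauchy_schwarz (R : realFieldType) (I : Type) (s : seq I) (x y : I -> R) :
  (\sum_(i <- s) x i * y i) ^+ 2 <=
  (\sum_(i <- s) x i ^+ 2) * (\sum_(i <- s) y i ^+ 2).
Proof.
have : 0 <= \sum_(i <- s) \sum_(j <- s) (x i * y j - x j * y i) ^+ 2.
  by apply: sumr_ge0 => i _; apply: sumr_ge0 => j _; exact: sqr_ge0.
have -> : \sum_(i <- s) \sum_(j <- s) (x i * y j - x j * y i) ^+ 2 =
    \sum_(i <- s) \sum_(j <- s) (x i ^+ 2 * y j ^+ 2) +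
    \sum_(i <- s) \sum_(j <- s) (x j ^+ 2 * y i ^+ 2) -
    2 * \sum_(i <- s) \sum_(j <- s) ((x i * y i) * (x j * y j)).
  rewrite mulr_sumr -sumrN -!big_split /=; apply: eq_bigr => i _.
  rewrite mulr_sumr -sumrN -!big_split /=; apply: eq_bigr => j _; ring.
rewrite [X in _ + X - _]exchange_big /=.
under eq_bigr do rewrite -mulr_sumr.
under [X in _ - _ * X]eq_bigr do rewrite -mulr_sumr.
by rewrite -!mulr_suml expr2; lra.
Qed.

Lemma sum_inj_le (R : realDomainType) (I : eqType) (f : I -> R) (A : R)
    (g : I -> I) (s : seq I) :
  (forall s : seq I, uniq s -> \sum_(i <- s) f i <= A) ->
  injective g -> uniq s -> \sum_(i <- s) f (g i) <= A.
Proof.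
move=> fA ig us; rewrite -(big_map g predT f); apply: fA.
by rewrite map_inj_uniq.
Qed.

(** Cauchy-Schwarz for the factors sqrt u and (sqrt u) y. *)
Lemma weighted_sqr_sum (R : rcfType) (I : Type) (T : seq I) (u y : I -> R)
    (C : R) :
  (forall h, 0 <= u h) -> \sum_(h <- T) u h <= C ->
  (\sum_(h <- T) u h * y h) ^+ 2 <= C * \sum_(h <- T) u h * y h ^+ 2.
Proof.
move=> u0 uC.
have -> : \sum_(h <- T) u h * y h =
    \sum_(h <- T) Num.sqrt (u h) * (Num.sqrt (u h) * y h).
  by apply: eq_bigr => h _; rewrite mulrA -expr2 sqr_sqrtr.
apply: (le_trans (cauchy_schwarz _ _ _)).
under eq_bigr do rewrite sqr_sqrtr//.
under [X in _ * X]eq_bigr do rewrite exprMn sqr_sqrtr//.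
by rewrite ler_wpM2r// sumr_ge0// => h _; rewrite mulr_ge0// sqr_ge0.
Qed.

(** Young's inequality for l^2 * l^1: the weight g (k - h) has total mass at
most B, both as a function of h and as a function of k. *)
Lemma young_l2_l1 (R : rcfType) (I : zmodType) (f g : I -> R) (A B : R)
    (S T : seq I) :
  (forall h, 0 <= g h) ->
  (forall s, uniq s -> \sum_(h <- s) f h ^+ 2 <= A ^+ 2) ->
  (forall s, uniq s -> \sum_(h <- s) g h <= B) ->
  uniq S -> uniq T ->
  \sum_(k <- S) (\sum_(h <- T) f h * g (k - h)) ^+ 2 <= (A * B) ^+ 2.
Proof.
move=> g0 fA gB uS uT.
have B0 : 0 <= B by have := gB [::] isT; rewrite big_nil.
apply: (@le_trans _ _ (\sum_(k <- S) B * \sum_(h <- T) g (k - h) * f h ^+ 2)).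
  apply: ler_sum => k _; under eq_bigr do rewrite mulrC.
  apply: weighted_sqr_sum => //.
  apply: (sum_inj_le (f := g) (g := fun h => k - h)) => //.
  by move=> x y /addrI /oppr_inj.
rewrite -mulr_sumr exchange_big /= [leRHS]exprMn.
have -> : A ^+ 2 * B ^+ 2 = B * (B * A ^+ 2) by ring.
rewrite ler_wpM2l//.
apply: (@le_trans _ _ (\sum_(h <- T) B * f h ^+ 2)).
  apply: ler_sum => h _; rewrite -mulr_suml ler_wpM2r ?sqr_ge0//.
  apply: (sum_inj_le (f := g) (g := fun k => k - h)) => //; exact: addIr.
by rewrite -mulr_sumr ler_wpM2l// fA.
Qed.

(** The same with the roles exchanged.  It is not a consequence of young_l2_l1
by the substitution of k - h for h, since this would make the range of summation
depend on k. *)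
Lemma young_l1_l2 (R : rcfType) (I : zmodType) (f g : I -> R) (A B : R)
    (S T : seq I) :
  (forall h, 0 <= f h) ->
  (forall s, uniq s -> \sum_(h <- s) f h <= A) ->
  (forall s, uniq s -> \sum_(h <- s) g h ^+ 2 <= B ^+ 2) ->
  uniq S -> uniq T ->
  \sum_(k <- S) (\sum_(h <- T) f h * g (k - h)) ^+ 2 <= (A * B) ^+ 2.
Proof.
move=> f0 fA gB uS uT.
have A0 : 0 <= A by have := fA [::] isT; rewrite big_nil.
apply: (@le_trans _ _ (\sum_(k <- S) A * \sum_(h <- T) f h * g (k - h) ^+ 2)).
  by apply: ler_sum => k _; apply: weighted_sqr_sum => //; exact: fA.
rewrite -mulr_sumr exchange_big /= [leRHS]exprMn.
have -> : A ^+ 2 * B ^+ 2 = A * (A * B ^+ 2) by ring.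
rewrite ler_wpM2l//.
apply: (@le_trans _ _ (\sum_(h <- T) f h * B ^+ 2)).
  apply: ler_sum => h _; rewrite -mulr_sumr ler_wpM2l//.
  apply: (sum_inj_le (f := fun k => g k ^+ 2) (g := fun k => k - h)) => //.
  exact: addIr.
by rewrite -mulr_suml ler_wpM2r ?sqr_ge0// fA.
Qed.

(** Estimates by finite sums whose range depends on j can use one common
range, because the terms are nonnegative. *)
Lemma common_seq (R : realDomainType) (J I : eqType) (s : seq J)
    (x : J -> R) (Q : J -> I -> R) :
  (forall j i, 0 <= Q j i) ->
  (forall j, j \in s -> exists2 T, uniq T & x j <= \sum_(i <- T) Q j i) ->
  exists2 T, uniq T & forall j, j \in s -> x j <= \sum_(i <- T) Q j i.
Proof.
move=> Q0; elim: s => [|j s IH] H; first by exists [::].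
have [|T uT HT] := IH; first by move=> i si; apply: H; rewrite inE si orbT.
have [|U uU HU] := H j; first by rewrite mem_head.
exists (undup (T ++ U)); first exact: undup_uniq.
move=> i; rewrite inE => /predU1P[->|si].
  apply: (le_trans HU); apply: sum_subset_le => //; first exact: undup_uniq.
  by move=> k kU; rewrite mem_undup mem_cat kU orbT.
apply: (le_trans (HT _ si)); apply: sum_subset_le => //.
  exact: undup_uniq.
by move=> k kT; rewrite mem_undup mem_cat kT.
Qed.

(** * Summability of negative powers over the lattice *)

(** Cauchy condensation: each of the 2^j terms of index in [2^j, 2^(j+1)) is
at most 2^(- j s). *)
Lemma dyadic_sum_le (R : realType) (s : R) (m : nat) : 1 < s ->
  \sum_(0 <= i < 2 ^ m) (maxn 1 i)%:R `^ (- s) <=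
  1 + \sum_(0 <= j < m) (2 `^ (1 - s)) ^+ j.
Proof.
move=> s1; elim: m => [|m IH].
  by rewrite expn0 big_nat1 big_geq// addr0 maxn0 powR1.
rewrite (@big_cat_nat _ _ _ (2 ^ m)%N)//=; last by rewrite leq_exp2l.
rewrite big_nat_recr//= addrA lerD//.
apply: (@le_trans _ _ (\sum_(2 ^ m <= i < 2 ^ m.+1) (2 ^ m)%:R `^ (- s))).
  rewrite big_nat [leRHS]big_nat; apply: ler_sum => i /andP[mi _].
  have i0 : (0 < i)%N by apply: leq_trans mi; rewrite expn_gt0.
  have -> : maxn 1 i = i by apply/maxn_idPr.
  rewrite !powRN lef_pV2 ?posrE ?powR_gt0 ?ltr0n ?expn_gt0//.
  by rewrite ge0_ler_powR ?nnegrE ?ler_nat// ltW// (lt_trans _ s1).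
rewrite sumr_const_nat expnS mul2n -addnn addnK.
rewrite -powR_mulrn ?powR_ge0// -powRrM -[leLHS]mulr_natl !natrX.
rewrite -[2 ^+ m]powR_mulrn// -powRrM -powRD; last by rewrite pnatr_eq0 implybT.
by rewrite le_eqVlt; apply/orP; left; apply/eqP; congr powR; ring.
Qed.

Lemma zeta_bound (R : realType) (s : R) : 1 < s ->
  exists2 Z : R, 0 < Z &
    forall N : nat, \sum_(0 <= i < N) (maxn 1 i)%:R `^ (- s) <= Z.
Proof.
move=> s1; set q : R := 2 `^ (1 - s).
have q0 : 0 < q by rewrite powR_gt0.
have q1 : q < 1.
  rewrite /q -opprB powRN invf_lt1 ?powR_gt0//.
  have := @gt0_ltr_powR R (s - 1) _ 1 2; rewrite powR1; apply.
  - by rewrite subr_gt0.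
  - by rewrite nnegrE.
  - by rewrite nnegrE.
  - by rewrite ltr1n.
have iq : 0 < (1 - q)^-1 by rewrite invr_gt0 subr_gt0.
exists (1 + (1 - q)^-1); first by rewrite addr_gt0.
move=> N; apply: (@le_trans _ _ (\sum_(0 <= i < 2 ^ N) (maxn 1 i)%:R `^ (- s))).
  rewrite [leRHS](@big_cat_nat _ _ _ N)//=; last by rewrite ltnW// ltn_expl.
  by rewrite lerDl sumr_ge0// => i _; exact: powR_ge0.
apply: (le_trans (dyadic_sum_le _ s1)); rewrite lerD2l -/q.
rewrite big_mkord -[leRHS]mul1r ler_pdivlMr ?subr_gt0// mulrC -opprB mulNr.
by rewrite -subrX1 opprB lerBlDr lerDl exprn_ge0// ltW.
Qed.

(** For k <> 0, |k| >= max (1, |k_r|) for each of the d coordinates, so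
|k|^d is at least the product of these maxima.  For k = 0 the left-hand side is
0 by the convention on powers of 0. *)
Lemma fnorm_powRN_le (R : realType) (d : nat) (n : R) (k : 'rV[int]_d) :
  (0 < d)%N -> 0 < n ->
  fnorm R k `^ (- (2 * n)) <=
  \prod_(r < d) (maxn 1 (absz (k 0 r)))%:R `^ (- (2 * n / d%:R)).
Proof.
move=> d0 n0; set t := 2 * n / d%:R.
have t0 : 0 < t by rewrite divr_gt0 ?mulr_gt0// ltr0n.
have [->|k0] := eqVneq k 0.
  rewrite fnorm0 powR0 ?oppr_eq0 ?gt_eqF ?mulr_gt0//.
  by apply: prodr_ge0 => r _; exact: powR_ge0.
have k1 := fnorm_ge1 R k0.
have kp : 0 < fnorm R k by apply: lt_le_trans k1.
have -> : fnorm R k `^ (- (2 * n)) = \prod_(r < d) fnorm R k `^ (- t).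
  rewrite prodr_const card_ord -powR_mulrn ?powR_ge0// -powRrM mulNr divfK//.
  by rewrite pnatr_eq0 -lt0n.
apply: ler_prod => r _; rewrite powR_ge0 /=.
have m1 : (0 < maxn 1 (absz (k ord0 r)))%N by rewrite leq_max.
rewrite !powRN lef_pV2 ?posrE ?powR_gt0 ?ltr0n//.
rewrite ge0_ler_powR ?nnegrE ?fnorm_ge0// ?(ltW t0)//.
rewrite /maxn; case: ifP => _ //.
by have := le_fnorm R k r; rewrite -intr_norm -abszE.
Qed.

(** By fnorm_powRN_le the sum is dominated by a product of d one-dimensional
sums with exponent 2 n / d > 1.  The integers k_r are encoded by absolute value
and sign in order to sum over a finite type. *)
Lemma lattice_sum (R : realType) (d : nat) (n : R) :
  (0 < d)%N -> d%:R / 2 < n ->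
  exists2 Z : R, 0 < Z & forall s : seq 'rV[int]_d, uniq s ->
    \sum_(k <- s) fnorm R k `^ (- (2 * n)) <= Z.
Proof.
move=> d0 dn; have dR : 0 < d%:R :> R by rewrite ltr0n.
have n0 : 0 < n by apply: lt_trans dn; rewrite divr_gt0.
have t1 : 1 < 2 * n / d%:R.
  by rewrite ltr_pdivlMr// mul1r mulrC -ltr_pdivrMr.
have [Z Z0 HZ] := zeta_bound t1; set t := 2 * n / d%:R in t1 HZ.
exists ((2 * Z) ^+ d); first by rewrite exprn_gt0// mulr_gt0.
move=> s us.
set N := (\sum_(k <- s) \sum_(r < d) absz (k ord0 r))%N.
pose phi (u : 'I_N.+1 * bool) : R := (maxn 1 u.1)%:R `^ (- t).
(* for k in s all coordinates are at most N, so inord does not truncate *)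
pose f (k : 'rV[int]_d) : {ffun 'I_d -> 'I_N.+1 * bool} :=
  [ffun r => (inord (absz (k 0 r)), k 0 r < 0)].
have ltN k r : k \in s -> (absz (k ord0 r) < N.+1)%N.
  move=> ks; rewrite ltnS /N (big_rem _ ks) /= (bigD1 r)//= -addnA.
  exact: leq_addr.
have fE k r : k \in s -> (f k r).1 = (absz (k 0 r)) :> nat.
  by move=> ks; rewrite ffunE /= inordK// ltN.
have finj : {in s &, injective f}.
  move=> k l ks ls fkl; apply/rowP => r.
  have E1 : (absz (k 0 r)) = (absz (l 0 r)) by rewrite -!fE// fkl.
  have E2 : (k 0 r < 0) = (l 0 r < 0).
    by have := congr1 (fun F : {ffun _ -> _} => (F r).2) fkl; rewrite !ffunE.
  (* an integer is determined by its absolute value and its sign *)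
move: E1 E2; clear; move: (k 0 r) (l 0 r) => a b; lia.
apply: (@le_trans _ _ (\sum_(k <- s) \prod_(r < d) phi (f k r))).
  rewrite big_seq [leRHS]big_seq; apply: ler_sum => k ks.
  apply: (le_trans (fnorm_powRN_le k d0 n0)).
  rewrite le_eqVlt; apply/orP; left; apply/eqP.
  by apply: eq_bigr => r _; rewrite /phi fE.
rewrite -(big_map f predT (fun F : {ffun _ -> _} => \prod_(r < d) phi (F r))).
rewrite big_uniq /=; last by rewrite map_inj_in_uniq.
apply: (@le_trans _ _ (\sum_(F : {ffun 'I_d -> 'I_N.+1 * bool})
    \prod_(r < d) phi (F r))).
  rewrite [leRHS](bigID [in map f s]) /= lerDl sumr_ge0// => F _.
  by apply: prodr_ge0 => r _; exact: powR_ge0.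
rewrite -(bigA_distr_bigA (fun (_ : 'I_d) u => phi u)) prodr_const card_ord.
rewrite lerXn2r ?nnegrE ?mulr_ge0 ?(ltW Z0)//.
  by apply: sumr_ge0 => u _; exact: powR_ge0.
rewrite -(pair_big predT predT (fun i b => phi (i, b))) /=.
under eq_bigr do rewrite big_bool /phi /=.
rewrite big_split /= mulr_natl mulr2n.
by rewrite lerD// -(big_mkord predT (fun i => (maxn 1 i)%:R `^ (- t))).
Qed.

(** * Upper bound for the admissible constants *)

Lemma hnorm_term (R : realType) (d : nat) (m : R) (v : vdist R d)
    (k : 'rV[int]_d) :
  vnorm (toC R k) `^ (2 * m) * vnorm (v k) ^+ 2 =
  (fnorm R k `^ m * vnorm (v k)) ^+ 2.
Proof.
by rewrite exprMn -[in RHS]powR_mulrn ?powR_ge0// -powRrM (mulrC m).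
Qed.

(** The term of index 0, which the norm omits, vanishes here because v 0 = 0;
hence the sums may run over arbitrary frequencies. *)
Lemma hnorm_finP (R : realType) (d : nat) (m : R) (v : vdist R d) :
  v 0 = 0 -> (hnorm m v < +oo)%E ->
  exists A : R, [/\ hnorm m v = A%:E, 0 <= A &
    forall s : seq 'rV[int]_d, uniq s ->
      \sum_(k <- s) (fnorm R k `^ m * vnorm (v k)) ^+ 2 <= A ^+ 2].
Proof.
move=> v0; rewrite /hnorm.
under eq_esum do rewrite hnorm_term.
set D := [set k : 'rV[int]_d | k != 0].
set q := fun k => (fnorm R k `^ m * vnorm (v k)) ^+ 2.
have ge s : uniq s -> ((\sum_(k <- s) q k)%:E <= \esum_(k in D) (q k)%:E)%E.
  move=> us; rewrite (bigID (fun k => k != 0)) /= [X in _ + X]big1 ?addr0.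
    rewrite -big_filter; apply: esum_ge_seq; first by rewrite filter_uniq.
    by move=> k; rewrite mem_filter => /andP[].
  move=> k; rewrite negbK => /eqP ->; rewrite /q v0.
  by rewrite vnorm0 mulr0 expr0n.
move: ge; case: (esum _ _) => [x| |] ge //=.
- move=> _; have x0 : 0 <= x by have := ge [::] isT; rewrite big_nil lee_fin.
  exists (Num.sqrt x); split => //.
  by move=> s us; rewrite sqr_sqrtr//; have := ge s us; rewrite lee_fin.
- by have := ge [::] isT.
Qed.

Lemma hnorm_le (R : realType) (d : nat) (m A : R) (v : vdist R d) :
  0 <= A ->
  (forall s : seq 'rV[int]_d, uniq s -> (forall k, k \in s -> k != 0) ->
    \sum_(k <- s) (fnorm R k `^ m * vnorm (v k)) ^+ 2 <= A ^+ 2) ->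
  (hnorm m v <= A%:E)%E.
Proof.
move=> A0 H; rewrite /hnorm.
under eq_esum do rewrite hnorm_term.
have := @esum_le_seq _ _ [set k : 'rV[int]_d | k != 0] _ _ H.
case: (esum _ _) => [x| |] //=; rewrite ?lee_fin// => xA.
by rewrite -[leRHS](ger0_norm A0) -sqrtr_sqr ler_wsqrtr.
Qed.

Lemma hnorm_mono (R : realType) (d : nat) (m m' : R) (v : vdist R d) :
  m <= m' -> (hnorm m v <= hnorm m' v)%E.
Proof.
move=> mm; rewrite /hnorm; rewrite lee_sqrt.
  apply: le_esum => k k0.
  rewrite lee_fin ler_wpM2r ?sqr_ge0// ler_powR ?ler_pM2l//.
  exact: fnorm_ge1.
by apply: esum_ge0 => k _; rewrite lee_fin mulr_ge0 ?powR_ge0 ?sqr_ge0.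
Qed.

(** Cauchy-Schwarz for the factors |k|^(n+j) |v_k| and |k|^(-n). *)
Lemma l1_le_weighted_l2 (R : realType) (d : nat) (n j A Z : R) (v : vdist R d) :
  v 0 = 0 -> 0 <= A -> 0 <= Z ->
  (forall s : seq 'rV[int]_d, uniq s ->
     \sum_(k <- s) fnorm R k `^ (- (2 * n)) <= Z) ->
  (forall s : seq 'rV[int]_d, uniq s ->
     \sum_(k <- s) (fnorm R k `^ (n + j) * vnorm (v k)) ^+ 2 <= A ^+ 2) ->
  forall s : seq 'rV[int]_d, uniq s ->
    \sum_(k <- s) fnorm R k `^ j * vnorm (v k) <= A * Num.sqrt Z.
Proof.
move=> v0 A0 Z0 HZ HA s us.
have -> : \sum_(k <- s) fnorm R k `^ j * vnorm (v k) =
    \sum_(k <- s) (fnorm R k `^ (n + j) * vnorm (v k)) * fnorm R k `^ (- n).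
  apply: eq_bigr => k _; have [->|k0] := eqVneq k 0.
    by rewrite v0 vnorm0 !mulr0 mul0r.
  have kp : fnorm R k != 0 by rewrite gt_eqF// (lt_le_trans _ (fnorm_ge1 R k0)).
  rewrite mulrAC -powRD; last by rewrite kp implybT.
  by rewrite addrAC subrr add0r.
rewrite -(@ler_pXn2r _ 2)// ?nnegrE ?mulr_ge0 ?sqrtr_ge0//; last first.
  by apply: sumr_ge0 => k _; rewrite !mulr_ge0 ?powR_ge0 ?vnorm_ge0.
apply: (le_trans (cauchy_schwarz _ _ _)).
rewrite exprMn sqr_sqrtr// ler_pM ?HA//.
- by apply: sumr_ge0 => k _; rewrite sqr_ge0.
- by apply: sumr_ge0 => k _; rewrite sqr_ge0.
apply: le_trans (HZ _ us); rewrite le_eqVlt; apply/orP; left; apply/eqP.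
apply: eq_bigr => k _.
by rewrite -[LHS]powR_mulrn ?powR_ge0// -powRrM mulNr (mulrC n).
Qed.

Lemma sum_addr_eq (R : zmodType) (I : zmodType) (T : seq I) (x : I -> R)
    (h k : I) :
  uniq T ->
  \sum_(l <- T) (if h + l == k then x l else 0) =
  if k - h \in T then x (k - h) else 0.
Proof.
move=> uT; case: ifPn => kT.
  rewrite (bigD1_seq (k - h))//= [h + _]addrC subrK eqxx big1 ?addr0//.
  move=> l lk; case: eqP => // E; move: lk.
  by rewrite -E addrC addKr eqxx.
rewrite big1_seq// => l /= lT; case: eqP => // E; move: kT.
by rewrite -E addrC addKr lT.
Qed.

Lemma trunc_conv_le (R : realType) (d : nat) (a b : dist R d)
    (T : seq 'rV[int]_d) (k : 'rV[int]_d) :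
  uniq T ->
  normc (trunc_conv a b T k) <= \sum_(h <- T) normc (a h) * normc (b (k - h)).
Proof.
move=> uT; apply: (le_trans (normc_sum _ _ _)); apply: ler_sum => h _.
rewrite (sum_addr_eq (fun l => a h * b l))//.
by case: ifP => _; rewrite ?Normc.normcM// Normc.normc0 mulr_ge0 ?normc_ge0.
Qed.

(** The factor 2 replaces a limit: unless the coefficient is 0, a close enough
approximation of it by a truncated convolution has at least half its modulus. *)
Lemma fourier_prod_le (R : realType) (d : nat) (a b : dist R d) (A B : R)
    (k : 'rV[int]_d) :
  (forall s : seq 'rV[int]_d, uniq s -> \sum_(h <- s) normc (a h) <= A) ->
  (forall s : seq 'rV[int]_d, uniq s -> \sum_(h <- s) normc (b h) <= B) ->
  exists2 T, uniq T & normc (fourier (fun x => tofun a x * tofun b x) k) <=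
    2 * e_coef R d * \sum_(h <- T) normc (a h) * normc (b (k - h)).
Proof.
move=> aA bB; set F := fourier _ k.
have [F0|F0] := leP (normc F) 0.
  by exists [::] => //; rewrite big_nil mulr0.
have [T [uT _ HT]] :=
  fourier_prod_approx [::] k aA bB (divr_gt0 F0 (ltr0n R 2 : 0 < 2)).
exists T => //.
rewrite -/F in HT; have Hc := trunc_conv_le a b k uT.
have : normc F <= normc F / 2 + e_coef R d * normc (trunc_conv a b T k).
  rewrite -[X in normc X <= _](subrK ((e_coef R d)%:C * trunc_conv a b T k) F).
  rewrite (le_trans (le_normcD _ _))// lerD// Normc.normcM normcR.
  by rewrite gtr0_norm// e_coef_gt0.
have : e_coef R d * normc (trunc_conv a b T k) <=
    e_coef R d * \sum_(h <- T) normc (a h) * normc (b (k - h)).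
  by rewrite ler_pM2l ?e_coef_gt0.
rewrite -mulrA; lra.
Qed.

Lemma fourier_sum (R : realType) (d : nat) (I : Type) (s : seq I)
    (f : I -> 'rV[R]_d -> R[i]) (k : 'rV[int]_d) :
  (forall i, cbucont (f i)) ->
  fourier (fun x => \sum_(i <- s) f i x) k = \sum_(i <- s) fourier (f i) k.
Proof.
move=> cf.
rewrite -[LHS]/(cintegral (fun x => conjc (e_ k x) * \sum_(i <- s) f i x)).
rewrite (_ : (fun _ => _) = fun x => \sum_(i <- s) conjc (e_ k x) * f i x).
  rewrite cintegral_sum// => i; apply: cbucontM => //.
  exact/cbucont_conj/cbucont_e.
by apply/funext => x; rewrite mulr_sumr.
Qed.

Lemma normc_partial (R : realType) (d : nat) (w : vdist R d) (r s : 'I_d)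
    (l : 'rV[int]_d) :
  normc (partial r (component w s) l) <= fnorm R l * vnorm (w l).
Proof.
rewrite /partial /component !Normc.normcM.
rewrite normc_i mul1r ler_pM ?normc_ge0 ?normc_vnorm//.
by rewrite normc_int le_fnorm.
Qed.

Lemma advectionE (R : realType) (d : nat) (v w : vdist R d) (V W : R)
    (k : 'rV[int]_d) (s : 'I_d) :
  (forall t : seq 'rV[int]_d, uniq t -> \sum_(h <- t) vnorm (v h) <= V) ->
  (forall t : seq 'rV[int]_d, uniq t ->
     \sum_(h <- t) fnorm R h * vnorm (w h) <= W) ->
  advection v w k 0 s = \sum_(r < d) fourier (fun x =>
    tofun (component v r) x * tofun (partial r (component w s)) x) k.
Proof.
move=> vV wW; rewrite mxE; apply: fourier_sum => r; apply: cbucontM.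
  apply: (@cbucont_tofun _ _ _ V) => t ut; apply: le_trans (vV _ ut).
  by apply: ler_sum => h _; exact: normc_vnorm.
apply: (@cbucont_tofun _ _ _ W) => t ut; apply: le_trans (wW _ ut).
by apply: ler_sum => h _; exact: normc_partial.
Qed.

Lemma advection_le (R : realType) (d : nat) (v w : vdist R d) (V W : R)
    (k : 'rV[int]_d) :
  (forall t : seq 'rV[int]_d, uniq t -> \sum_(h <- t) vnorm (v h) <= V) ->
  (forall t : seq 'rV[int]_d, uniq t ->
     \sum_(h <- t) fnorm R h * vnorm (w h) <= W) ->
  exists2 T, uniq T & forall s, normc (advection v w k 0 s) <=
    \sum_(h <- T) (d%:R * (2 * e_coef R d)) *
      (vnorm (v h) * (fnorm R (k - h) * vnorm (w (k - h)))).
Proof.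
move=> vV wW; set c := 2 * e_coef R d.
have c0 : 0 <= c by rewrite mulr_ge0// ltW// e_coef_gt0.
pose Q h := vnorm (v h) * (fnorm R (k - h) * vnorm (w (k - h))).
have Q0 h : 0 <= Q h by rewrite !mulr_ge0 ?vnorm_ge0.
pose X (rs : 'I_d * 'I_d) := normc (fourier (fun x =>
  tofun (component v rs.1) x * tofun (partial rs.1 (component w rs.2)) x) k).
have [||T uT HT] := @common_seq R _ _ (enum [set: 'I_d * 'I_d]%SET) X
    (fun _ h => c * Q h).
- by move=> _ h; rewrite mulr_ge0.
- move=> [r s] _; have [||T uT HT] := @fourier_prod_le R d (component v r)
    (partial r (component w s)) V W k.
  + move=> t ut; apply: le_trans (vV _ ut).
    by apply: ler_sum => h _; exact: normc_vnorm.
  + move=> t ut; apply: le_trans (wW _ ut).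
    by apply: ler_sum => h _; exact: normc_partial.
  exists T => //; apply: (le_trans HT); rewrite -mulr_sumr ler_wpM2l//.
  apply: ler_sum => h _.
  by rewrite ler_pM ?normc_ge0 ?normc_vnorm ?normc_partial.
exists T => // s; rewrite (advectionE _ _ vV wW).
apply: (le_trans (normc_sum _ _ _)).
apply: (@le_trans _ _ (\sum_(r < d) \sum_(h <- T) c * Q h)).
  by apply: ler_sum => r _; apply: (HT (r, s)); rewrite mem_enum inE.
by rewrite sumr_const card_ord -[leLHS]mulr_natl -!mulr_sumr mulrA.
Qed.

(** The subtracted vector is the component of u k along k, and each of its
coordinates is at most d x in modulus. *)
Lemma leray_le (R : realType) (d : nat) (u : vdist R d) (k : 'rV[int]_d)
    (x : R) :
  k != 0 -> (forall s, normc (u k 0 s) <= x) ->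
  vnorm (leray u k) <= d%:R * ((1 + d%:R) * x).
Proof.
move=> k0 ux; have k1 := fnorm_ge1 R k0.
have kp : 0 < fnorm R k by apply: lt_le_trans k1.
apply: (le_trans (vnorm_le_sum _)).
rewrite mulr_natl -[X in _ *+ X](card_ord d) -sumr_const; apply: ler_sum => s _.
rewrite /leray (negbTE k0) !mxE.
apply: (le_trans (le_normcD _ _)); rewrite mulrDl mul1r lerD//.
rewrite normcN !Normc.normcM Normc.normcV normcR normc_int.
rewrite ger0_norm ?sqr_ge0// -/(fnorm R k).
apply: (@le_trans _ _ ((d%:R * x * fnorm R k) / fnorm R k ^+ 2 * fnorm R k)).
  rewrite ler_pM ?le_fnorm// ?mulr_ge0 ?normc_ge0 ?invr_ge0 ?sqr_ge0//.
  rewrite ler_wpM2r ?invr_ge0 ?sqr_ge0//.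
  apply: (le_trans (normc_sum _ _ _)).
  rewrite -mulrA mulr_natl -[X in _ *+ X](card_ord d) -sumr_const.
  apply: ler_sum => r _; rewrite Normc.normcM mulrC ler_pM ?normc_ge0//.
  exact: normc_vnorm.
rewrite le_eqVlt; apply/orP; left; apply/eqP; field; exact: lt0r_neq0.
Qed.

Lemma le_mul_split (R : realDomainType) (a b c t x u : R) :
  a <= t * (b + c) -> 0 <= x -> 0 <= u ->
  a * (x * u) <= t * (b * x * u + x * (c * u)).
Proof.
move=> abc x0 u0; have -> : t * (b * x * u + x * (c * u)) =
  t * (b + c) * (x * u) by ring.
by rewrite ler_wpM2r// mulr_ge0.
Qed.

Opaque fnorm.

Lemma fnorm_sub_powR (R : realType) (d : nat) (h k : 'rV[int]_d) (p : R) :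
  0 <= p -> fnorm R k `^ p <= 2 `^ p * (fnorm R h `^ p + fnorm R (k - h) `^ p).
Proof. by move=> p0; have := fnorm_add_powR h (k - h) p0; rewrite subrKC. Qed.

Lemma powR_succ (R : realType) (x p : R) :
  0 <= x -> 0 < p -> x `^ (p + 1) = x `^ p * x.
Proof.
move=> x0 p0; rewrite powRD ?powRr1//.
by rewrite gt_eqF// addr_gt0.
Qed.

(** The l^1 bounds on v and on the gradient of w come from
l1_le_weighted_l2 with j = 0 and j = 1. *)
Lemma admissible_pow2 (R : realType) (d : nat) (n : R) :
  (0 < d)%N -> d%:R / 2 < n ->
  exists2 C : R, 0 < C & forall p, n <= p -> admissible d p n (C * 2 `^ p).
Proof.
move=> d0 dn; have dR : 0 < d%:R :> R by rewrite ltr0n.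
have n0 : 0 < n by apply: lt_trans dn; rewrite divr_gt0.
have [Z Z0 HZ] := lattice_sum d0 dn.
set c := d%:R * (2 * e_coef R d).
have c0 : 0 < c by rewrite !mulr_gt0 ?e_coef_gt0.
set C1 := d%:R * ((1 + d%:R) * c).
have d1 : 0 < 1 + d%:R :> R by rewrite addr_gt0.
have C10 : 0 < C1 by rewrite mulr_gt0// mulr_gt0.
have sZ : 0 < Num.sqrt Z by rewrite sqrtr_gt0.
exists (4 * C1 * Num.sqrt Z); first by rewrite mulr_gt0// mulr_gt0.
move=> p np v w [_ _ v0 vp] [_ _ w0 wp].
have p0 : 0 < p by apply: lt_le_trans np.
have vn : (hnorm n v < +oo)%E by apply: le_lt_trans vp; exact: hnorm_mono.
have wn : (hnorm (n + 1) w < +oo)%E.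
  by apply: le_lt_trans wp; apply: hnorm_mono; rewrite lerD2r.
have [Ap [-> Ap0 HAp]] := hnorm_finP v0 vp.
have [An [-> An0 HAn]] := hnorm_finP v0 vn.
have [Bp [-> Bp0 HBp]] := hnorm_finP w0 wp.
have [Bn [-> Bn0 HBn]] := hnorm_finP w0 wn.
set K := 2^-1 * _.
rewrite (_ : (K%:E * _)%E = (K * (Ap * Bn + An * Bp))%:E)//.
have vV (t : seq 'rV[int]_d) : uniq t ->
    \sum_(h <- t) vnorm (v h) <= An * Num.sqrt Z.
  move=> ut; have := @l1_le_weighted_l2 R d n 0 An Z v v0 An0 (ltW Z0) HZ.
  rewrite addr0.
  move=> /(_ HAn t ut); under eq_bigr do rewrite powRr0 mul1r.
  by [].
have wW (t : seq 'rV[int]_d) : uniq t ->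
    \sum_(h <- t) fnorm R h * vnorm (w h) <= Bn * Num.sqrt Z.
  move=> ut.
  have := @l1_le_weighted_l2 R d n 1 Bn Z w w0 Bn0 (ltW Z0) HZ HBn t ut.
  by under eq_bigr do rewrite powRr1 ?fnorm_ge0//.
have E2 : 0 < 2 `^ p :> R by rewrite powR_gt0.
set D := K * _; have D0 : 0 <= D.
  apply: mulr_ge0; last by rewrite addr_ge0 ?mulr_ge0.
  by rewrite mulr_ge0// ltW// mulr_gt0// mulr_gt0// mulr_gt0.
apply: hnorm_le => // S uS S0.
pose Q (k h : 'rV[int]_d) :=
  c * (vnorm (v h) * (fnorm R (k - h) * vnorm (w (k - h)))).
have Q0 k h : 0 <= Q k h.
  by apply: mulr_ge0; rewrite ?(ltW c0)// !mulr_ge0 ?vnorm_ge0.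
have PQ k : k \in S -> exists2 T, uniq T &
    vnorm (P_ v w k) / (d%:R * (1 + d%:R)) <= \sum_(h <- T) Q k h.
  move=> kS; have [T uT HT] := advection_le k vV wW; exists T => //.
  rewrite ler_pdivrMr ?mulr_gt0// mulrC -mulrA.
  exact: (leray_le (S0 _ kS) HT).
have [T uT HT] := common_seq Q0 PQ.
have HBp' (s : seq 'rV[int]_d) : uniq s ->
    \sum_(l <- s) (fnorm R l `^ p * (fnorm R l * vnorm (w l))) ^+ 2 <= Bp ^+ 2.
  move=> us; have := HBp _ us; congr (_ <= _); apply: eq_bigr => l _.
  by rewrite powR_succ ?fnorm_ge0// mulrA.
pose a k := \sum_(h <- T) (fnorm R h `^ p * vnorm (v h)) *
  (fnorm R (k - h) * vnorm (w (k - h))).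
pose b k := \sum_(h <- T) vnorm (v h) *
  (fnorm R (k - h) `^ p * (fnorm R (k - h) * vnorm (w (k - h)))).
have a0 k : 0 <= a k.
  by apply: sumr_ge0 => h _; rewrite !mulr_ge0 ?powR_ge0 ?vnorm_ge0 ?fnorm_ge0.
have b0 k : 0 <= b k.
  by apply: sumr_ge0 => h _; rewrite !mulr_ge0 ?powR_ge0 ?vnorm_ge0 ?fnorm_ge0.
have step k : k \in S ->
    fnorm R k `^ p * vnorm (P_ v w k) <= C1 * 2 `^ p * (a k + b k).
  move=> kS; have := HT _ kS.
  rewrite ler_pdivrMr ?mulr_gt0// => H.
  apply: (@le_trans _ _ (fnorm R k `^ p * ((\sum_(h <- T) Q k h) *
     (d%:R * (1 + d%:R))))); first by rewrite ler_wpM2l ?powR_ge0.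
  rewrite /Q -mulr_sumr.
  have -> (x y : R) : x * (c * y * (d%:R * (1 + d%:R))) = C1 * (x * y).
    by rewrite /C1; ring.
  rewrite -mulrA ler_pM2l// mulr_sumr -big_split /= mulr_sumr.
  apply: ler_sum => h _.
  have Hk := fnorm_sub_powR h k (ltW p0).
  by apply: le_mul_split => //; rewrite ?mulr_ge0 ?vnorm_ge0 ?fnorm_ge0.
have Ya : \sum_(k <- S) a k ^+ 2 <= (Ap * (Bn * Num.sqrt Z)) ^+ 2.
  apply: (@young_l2_l1 R _ (fun h => fnorm R h `^ p * vnorm (v h))
    (fun h => fnorm R h * vnorm (w h))) => // h.
  by rewrite mulr_ge0 ?fnorm_ge0 ?vnorm_ge0.
have Yb : \sum_(k <- S) b k ^+ 2 <= ((An * Num.sqrt Z) * Bp) ^+ 2.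
  apply: (@young_l1_l2 R _ (fun h => vnorm (v h))
    (fun h => fnorm R h `^ p * (fnorm R h * vnorm (w h)))) => // h.
  exact: vnorm_ge0.
set X := Ap * (Bn * _) in Ya; set Y := (An * _) * Bp in Yb.
have X0 : 0 <= X by rewrite !mulr_ge0// ltW.
have Y0 : 0 <= Y by rewrite !mulr_ge0// ltW.
have -> : D = C1 * 2 `^ p * (2 * (X + Y)).
  by rewrite /D /K /X /Y; field.
apply: (@le_trans _ _ (\sum_(k <- S)
    (C1 * 2 `^ p) ^+ 2 * (2 * a k ^+ 2 + 2 * b k ^+ 2))).
  rewrite big_seq [leRHS]big_seq; apply: ler_sum => k kS.
  apply: (@le_trans _ _ ((C1 * 2 `^ p * (a k + b k)) ^+ 2)).
    rewrite lerXn2r ?nnegrE ?step//.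
      by rewrite mulr_ge0 ?powR_ge0 ?vnorm_ge0.
    by rewrite mulr_ge0 ?addr_ge0// ltW// mulr_gt0.
  rewrite exprMn ler_wpM2l ?sqr_ge0//.
  have : 0 <= (a k - b k) ^+ 2 by rewrite sqr_ge0.
  lra.
rewrite -mulr_sumr [leRHS]exprMn ler_wpM2l ?sqr_ge0//.
rewrite big_split /= -!mulr_sumr.
have XY : 0 <= X * Y by rewrite mulr_ge0.
have : 0 <= X ^+ 2 by rewrite sqr_ge0.
have : 0 <= Y ^+ 2 by rewrite sqr_ge0.
lra.
Qed.

(** * Lower bound for the admissible constants *)

Lemma vnorm_toC (R : realType) (d : nat) (k : 'rV[int]_d) :
  vnorm (toC R k) = fnorm R k.
Proof. by []. Qed.

Lemma sqr_inj_nneg (R : realDomainType) (x y : R) :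
  0 <= x -> 0 <= y -> x ^+ 2 = y ^+ 2 -> x = y.
Proof. by move=> x0 y0 /eqP; rewrite eqrXn2// => /eqP. Qed.

Lemma fnormN (R : realType) (d : nat) (k : 'rV[int]_d) :
  fnorm R (- k) = fnorm R k.
Proof.
have H : fnorm R (- k) ^+ 2 = fnorm R k ^+ 2.
  by rewrite !fnorm_sqr; apply: eq_bigr => r _; rewrite mxE mulrNz sqrrN.
exact: (sqr_inj_nneg (fnorm_ge0 R _) (fnorm_ge0 R _) H).
Qed.

Lemma hnorm_ge (R : realType) (d : nat) (m : R) (v : vdist R d)
    (k : 'rV[int]_d) :
  k != 0 -> ((fnorm R k `^ m * vnorm (v k))%:E <= hnorm m v)%E.
Proof.
move=> k0; rewrite /hnorm; under eq_esum do rewrite hnorm_term.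
set q := fun k => _.
have := @esum_ge_seq R _ [set k : 'rV[int]_d | k != 0]
  (fun k => (fnorm R k `^ m * vnorm (v k)) ^+ 2) [:: k] isT.
rewrite big_seq1 => /(_ _); case: (esum _ _) => [x| |] //=; rewrite ?leey//.
  move=> H; rewrite lee_fin.
  have {}H : (fnorm R k `^ m * vnorm (v k)) ^+ 2 <= x.
    by rewrite -lee_fin; apply: H => i; rewrite inE => /eqP ->.
  rewrite -[leLHS]ger0_norm ?mulr_ge0 ?powR_ge0 ?vnorm_ge0//.
  by rewrite -sqrtr_sqr ler_wsqrtr.
move=> H; have /H : forall i, i \in [:: k] -> i != 0 => //.
by move=> i; rewrite inE => /eqP ->.
Qed.

(** A real vector field with the two frequencies u and - u and a real
coefficient c. *)
Definition two_mode (R : realType) (d : nat) (u c : 'rV[int]_d) : vdist R d :=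
  fun k => if (k == u) || (k == - u) then toC R c else 0.

Lemma sum_pair_le (R : realDomainType) (I : eqType) (a b : I) (X : R)
    (F : I -> R) (s : seq I) :
  0 <= X -> (forall k, F k <= if (k == a) || (k == b) then X else 0) ->
  uniq s -> \sum_(k <- s) F k <= 2 * X.
Proof.
move=> X0 FX us.
have one (x : I) : \sum_(k <- s) (if k == x then X else 0) <= X.
  case: (boolP (x \in s)) => xs.
    rewrite (bigD1_seq x)//= eqxx big1 ?addr0// => k /negbTE ->//.
  rewrite big1_seq// => k /= ks; case: eqP => // kx; move: xs.
  by rewrite -kx ks.
apply: (@le_trans _ _ (\sum_(k <- s) ((if k == a then X else 0) +
    (if k == b then X else 0)))).
  apply: ler_sum => k _; apply: (le_trans (FX k)).
  by case: (k == a); case: (k == b); rewrite /= ?addr0 ?add0r ?lerDl.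
by rewrite big_split /= mulr_natl mulr2n lerD.
Qed.

(** For u <> 0 the exact value has sqrt 2 in place of 2. *)
Lemma hnorm_two_mode_le (R : realType) (d : nat) (u c : 'rV[int]_d) (m : R) :
  (hnorm m (two_mode R u c) <= (2 * (fnorm R u `^ m * fnorm R c))%:E)%E.
Proof.
have X0 : 0 <= fnorm R u `^ m * fnorm R c.
  by rewrite mulr_ge0 ?powR_ge0 ?fnorm_ge0.
apply: hnorm_le; first by rewrite mulr_ge0.
move=> s us _.
apply: (@le_trans _ _ (2 * (fnorm R u `^ m * fnorm R c) ^+ 2)).
  apply: (@sum_pair_le _ _ u (- u)) => //; first exact: sqr_ge0.
  move=> k; rewrite /two_mode; case: ifP => [/orP[]/eqP ->|_].
  - by rewrite vnorm_toC.
  - by rewrite vnorm_toC fnormN.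
  - by rewrite vnorm0 mulr0 expr0n.
by rewrite [leRHS]exprMn ler_wpM2r ?sqr_ge0// expr2 ler_peMr// ler1n.
Qed.

Lemma map_conjc_toC (R : realType) (d : nat) (c : 'rV[int]_d) :
  map_mx conjc (toC R c) = toC R c.
Proof.
apply/rowP => i; rewrite !mxE.
by rewrite -[X in conjc X](rmorph_int (real_complex R)) conjc_real rmorph_int.
Qed.

Lemma dot_toC (R : realType) (d : nat) (k c : 'rV[int]_d) :
  dot (toC R k) (toC R c) = (dot k c)%:~R.
Proof.
rewrite /dot rmorph_sum; apply: eq_bigr => r _.
by rewrite !mxE rmorphM.
Qed.

Lemma two_mode_H (R : realType) (d : nat) (u c : 'rV[int]_d) (m : R) :
  u != 0 -> dot u c = 0 -> H_ m (two_mode R u c).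
Proof.
move=> u0 uc; split.
- move=> k; rewrite /two_mode.
  have -> : (- k == u) || (- k == - u) = (k == u) || (k == - u).
    by rewrite eqr_opp orbC -[- k == u]eqr_opp opprK.
  case: ifP => _; first by rewrite map_conjc_toC.
  by apply/rowP => i; rewrite !mxE conjc0.
- move=> k; rewrite /two_mode; case: ifP => [/orP[]/eqP ->|_].
  + by rewrite dot_toC uc.
  + have -> : dot (toC R (- u)) (toC R c) = (- dot u c)%:~R.
      rewrite dot_toC /dot -sumrN; congr (_%:~R).
      by apply: eq_bigr => r _; rewrite mxE mulNr.
    by rewrite uc oppr0.
  + by rewrite /dot big1// => r _; rewrite [X in _ * X]mxE mulr0.
- by rewrite /two_mode eq_sym (negbTE u0) eq_sym oppr_eq0 (negbTE u0).
- by apply: le_lt_trans (hnorm_two_mode_le _ _ _) _; rewrite ltry.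
Qed.

(** Only the product a h0 * b (k - h0) can be nonzero, so all truncated
convolutions over ranges containing both frequencies agree, and the error of the
approximation, being arbitrarily small, is zero. *)
Lemma fourier_prod_single (R : realType) (d : nat) (a b : dist R d) (A B : R)
    (h0 k : 'rV[int]_d) :
  (forall s : seq 'rV[int]_d, uniq s -> \sum_(h <- s) normc (a h) <= A) ->
  (forall s : seq 'rV[int]_d, uniq s -> \sum_(h <- s) normc (b h) <= B) ->
  (forall h, h != h0 -> a h * b (k - h) = 0) ->
  fourier (fun x => tofun a x * tofun b x) k =
  (e_coef R d)%:C * (a h0 * b (k - h0)).
Proof.
move=> aA bB ab0.
have cT T : uniq T -> {subset [:: h0; k - h0] <= T} ->
    trunc_conv a b T k = a h0 * b (k - h0).
  move=> uT sT; have h0T : h0 \in T by apply: sT; rewrite inE eqxx.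
  have kT : k - h0 \in T by apply: sT; rewrite !inE eqxx orbT.
  rewrite /trunc_conv
    (eq_bigr (fun h => if k - h \in T then a h * b (k - h) else 0)).
    by rewrite (bigD1_seq h0)//= kT big1 ?addr0// => h /ab0 ->; case: ifP.
  by move=> h _; rewrite (sum_addr_eq (fun l => a h * b l)).
apply/eqP; rewrite -subr_eq0; apply/eqP; apply: Normc.eq0_normc.
apply/eqP; rewrite eq_le normc_ge0 andbT; apply/ler_addgt0Pl => e e0.
have [T [uT sT HT]] := fourier_prod_approx [:: h0; k - h0] k aA bB e0.
by rewrite addr0; move: HT; rewrite cT.
Qed.

(** All the vectors of the example lie in the plane of the first two
coordinates. *)
Definition vec2 (d : nat) (a b : int) : 'rV[int]_d.+2 :=
  \row_i (if i == 0 :> nat then a else if i == 1 :> nat then b else 0)%N.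

Lemma sum_vec2 (V : nmodType) (d : nat) (a b a' b' : int)
    (f : int -> int -> V) :
  f 0 0 = 0 ->
  \sum_(r < d.+2) f (vec2 d a b 0 r) (vec2 d a' b' 0 r) = f a a' + f b b'.
Proof.
move=> f0; rewrite !big_ord_recl big1 ?addr0.
  by rewrite !mxE.
by move=> i _; rewrite !mxE.
Qed.

Lemma dot_vec2 (d : nat) (a b a' b' : int) :
  dot (vec2 d a b) (vec2 d a' b') = a * a' + b * b'.
Proof. by rewrite /dot (sum_vec2 _ _ _ _ _ (f := fun x y => x * y)) ?mulr0. Qed.

Lemma fnorm_vec2 (R : realType) (d : nat) (a b : int) :
  fnorm R (vec2 d a b) ^+ 2 = (a%:~R) ^+ 2 + (b%:~R) ^+ 2.
Proof.
rewrite fnorm_sqr (sum_vec2 _ a b a b (f := fun x _ => (x%:~R : R) ^+ 2))//.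
by rewrite expr0n.
Qed.

Lemma vec2_inj (d : nat) (a b a' b' : int) :
  vec2 d a b = vec2 d a' b' -> a = a' /\ b = b'.
Proof.
move=> /rowP E; have := E 0; have := E (lift 0 0).
by rewrite !mxE.
Qed.

Lemma vec2D (d : nat) (a b a' b' : int) :
  vec2 d a b + vec2 d a' b' = vec2 d (a + a') (b + b').
Proof.
apply/rowP => i; rewrite !mxE.
by do 2 (case: ifP => _ //); rewrite addr0.
Qed.

Lemma vec2N (d : nat) (a b : int) : - vec2 d a b = vec2 d (- a) (- b).
Proof.
by apply/rowP => i; rewrite !mxE; do 2 (case: ifP => _ //); rewrite oppr0.
Qed.

Lemma two_mode_l1 (R : realType) (d : nat) (u c : 'rV[int]_d)
    (t : seq 'rV[int]_d) :
  uniq t -> \sum_(h <- t) vnorm (two_mode R u c h) <= 2 * fnorm R c.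
Proof.
move=> ut; apply: (@sum_pair_le _ _ u (- u)) => //; first exact: fnorm_ge0.
by move=> k; rewrite /two_mode; case: ifP => _; rewrite ?vnorm_toC// vnorm0.
Qed.

Lemma two_mode_grad_l1 (R : realType) (d : nat) (u c : 'rV[int]_d)
    (t : seq 'rV[int]_d) :
  uniq t ->
  \sum_(h <- t) fnorm R h * vnorm (two_mode R u c h) <=
  2 * (fnorm R u * fnorm R c).
Proof.
move=> ut; apply: (@sum_pair_le _ _ u (- u)) => //.
  by rewrite mulr_ge0 ?fnorm_ge0.
move=> k; rewrite /two_mode; case: ifP => [/orP[]/eqP ->|_].
- by rewrite vnorm_toC.
- by rewrite vnorm_toC fnormN.
- by rewrite vnorm0 mulr0.
Qed.

(** Of the frequencies u and - u of the first field, only u can contribute to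
the coefficient of index u + u': the two hypotheses say that
u + u' - (- u) is not a frequency of the second field. *)
Lemma advection_two_mode (R : realType) (d : nat) (u c u' c' : 'rV[int]_d)
    (s : 'I_d) :
  u' + u + u != u' -> u' + u + u != - u' ->
  advection (two_mode R u c) (two_mode R u' c') (u + u') 0 s =
  (e_coef R d)%:C * (0 +i* 1) * (dot c u')%:~R * (c' 0 s)%:~R.
Proof.
move=> n1 n2.
rewrite (advectionE _ _ (@two_mode_l1 R d u c) (@two_mode_grad_l1 R d u' c')).
rewrite /dot rmorph_sum /= mulr_sumr mulr_suml; apply: eq_bigr => r _.
have ku : u + u' - u = u' by rewrite addrC addKr.
rewrite (@fourier_prod_single _ _ _ _ (2 * fnorm R c)
  (2 * (fnorm R u' * fnorm R c')) u).
- rewrite ku /partial /component /two_mode !eqxx /= !mxE rmorphM /=; ring.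
- move=> t ut; apply: le_trans (two_mode_l1 R u c ut).
  by apply: ler_sum => h _; exact: normc_vnorm.
- move=> t ut; apply: le_trans (two_mode_grad_l1 R u' c' ut).
  by apply: ler_sum => h _; exact: normc_partial.
- move=> h hu; rewrite /partial /component /two_mode (negbTE hu) /=.
  case: eqP => [->|_]; last by rewrite mxE mul0r.
  rewrite opprK (_ : u + u' + u = u' + u + u); last by rewrite (addrC u u').
  by rewrite (negbTE n1) (negbTE n2) /= [X in _ * (_ * X)]mxE !mulr0.
Qed.

(** The dimension is written d + 2 so that two coordinates are available. *)
Lemma admissible_ge_pow (R : realType) (d N : nat) (n : R) :
  (0 < N)%N -> 0 < n ->
  exists2 c : R, 0 < c & forall p K, 0 < p -> admissible d.+2 p n K ->
    c * (2 * N%:R / Num.sqrt (N%:R ^+ 2 + 1)) `^ p <= K.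
Proof.
move=> N0 n0; set M := Num.sqrt _.
have NR : 0 < N%:R :> R by rewrite ltr0n.
have M2 : M ^+ 2 = N%:R ^+ 2 + 1 by rewrite sqr_sqrtr// addr_ge0 ?sqr_ge0.
have M0 : 0 < M by rewrite sqrtr_gt0 ltr_wpDl ?sqr_ge0.
have knM (a b : int) : (a%:~R : R) ^+ 2 + b%:~R ^+ 2 = N%:R ^+ 2 + 1 ->
    fnorm R (vec2 d a b) = M.
  move=> E; apply: sqr_inj_nneg (fnorm_ge0 R _) (ltW M0) _.
  by rewrite fnorm_vec2 M2 E.
(* c is orthogonal to u and c' to u', while c . u' = 2N *)
pose u := vec2 d N (- 1); pose c := vec2 d 1 N.
pose u' := vec2 d N 1; pose c' := vec2 d 1 (- N%:Z).
have ku : fnorm R u = M by apply: knM; rewrite mulrNz sqrrN expr1n.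
have ku' : fnorm R u' = M by apply: knM; rewrite expr1n.
have kc : fnorm R c = M by apply: knM; rewrite expr1n addrC.
have kc' : fnorm R c' = M by apply: knM; rewrite mulrNz sqrrN expr1n addrC.
have knz (x : 'rV[int]_d.+2) : fnorm R x = M -> x != 0.
  by move=> xM; apply: contra_eq_neq xM => ->; rewrite fnorm0 lt_eqF.
have uH m : H_ m (two_mode R u c).
  by apply: two_mode_H; [exact: knz|rewrite dot_vec2; lia].
have u'H m : H_ m (two_mode R u' c').
  by apply: two_mode_H; [exact: knz|rewrite dot_vec2; lia].
set ef := e_coef R d.+2; have ef0 : 0 < ef := e_coef_gt0 R d.+2.
have Mn : 0 < M `^ n by rewrite powR_gt0.
exists (ef * (2 * N%:R ^+ 2) / (4 * (M `^ n * M ^+ 3))).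
  by rewrite divr_gt0 ?mulr_gt0 ?exprn_gt0.
move=> p K p0 /(_ _ _ (uH p) (u'H (p + 1))) HK.
set k := u + u'.
have kE : k = vec2 d (N%:Z + N%:Z) 0 by rewrite /k vec2D.
have k_n : fnorm R k = 2 * N%:R.
  apply: sqr_inj_nneg (fnorm_ge0 R _) (mulr_ge0 (ler0n _ _) (ler0n _ _)) _.
  by rewrite kE fnorm_vec2 intrD -[N%:~R]/(N%:R); ring.
have k0 : k != 0.
  apply: contra_eq_neq k_n => ->; rewrite fnorm0 lt_eqF// mulr_gt0//.
(* the second coordinate is orthogonal to k = (2N, 0), so the Leray projection
   does not change it *)
pose s1 : 'I_d.+2 := lift 0 0.
have Pk : normc (P_ (two_mode R u c) (two_mode R u' c') k 0 s1) =
    ef * (2 * N%:R ^+ 2).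
  rewrite /P_ /leray (negbTE k0) mxE [X in _ + X]mxE [X in _ - X]mxE.
  have -> : (toC R k) 0 s1 = 0 by rewrite kE !mxE.
  rewrite mulr0 subr0 advection_two_mode ?vec2D ?vec2N.
  - rewrite dot_vec2 !Normc.normcM normcR !normc_int (gtr0_norm ef0).
    rewrite normc_i mulr1 mul1r !mxE /= mulrNz normrN -[N%:~R]/(N%:R).
    rewrite intrD -[N%:~R]/(N%:R) !ger0_norm ?addr_ge0//; ring.
  - by apply/eqP => /vec2_inj[]; lia.
  - by apply/eqP => /vec2_inj[]; lia.
have lo : (((2 * N%:R) `^ p * (ef * (2 * N%:R ^+ 2)))%:E <=
    hnorm p (P_ (two_mode R u c) (two_mode R u' c')))%E.
  apply: le_trans (hnorm_ge p _ k0); rewrite lee_fin k_n ler_wpM2l ?powR_ge0//.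
  by rewrite -Pk normc_vnorm.
have {HK} := le_trans lo HK.
have fin m (x y : 'rV[int]_d.+2) :
    dot x y = 0 -> fnorm R x = M -> fnorm R y = M ->
    exists2 e : R, 0 <= e <= 2 * (M `^ m * M) & hnorm m (two_mode R x y) = e%:E.
  move=> xy xM yM; have [_ _ x0 xoo] := two_mode_H m (knz _ xM) xy.
  have [e [E e0 _]] := hnorm_finP x0 xoo; exists e => //.
  rewrite e0 -lee_fin -E.
  by have := @hnorm_two_mode_le R _ x y m; rewrite xM yM.
have uc0 : dot u c = 0 by rewrite dot_vec2; lia.
have uc0' : dot u' c' = 0 by rewrite dot_vec2; lia.
have [e1 /andP[e10 e1M] ->] := fin p u c uc0 ku kc.
have [e2 /andP[e20 e2M] ->] := fin (n + 1) u' c' uc0' ku' kc'.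
have [e3 /andP[e30 e3M] ->] := fin n u c uc0 ku kc.
have [e4 /andP[e40 e4M] ->] := fin (p + 1) u' c' uc0' ku' kc'.
move: e2M e4M; rewrite !powR_succ ?(ltW M0)// => e2M e4M.
set m := ef * (2 * N%:R ^+ 2); have m0 : 0 < m.
  by rewrite mulr_gt0// mulr_gt0// exprn_gt0.
set L := (2 * N%:R) `^ p * m; have L0 : 0 < L.
  by rewrite mulr_gt0// powR_gt0// mulr_gt0.
rewrite (_ : (_%:E * _)%E = (2^-1 * K * (e1 * e2 + e3 * e4))%:E)// lee_fin.
have Mp : 0 < M `^ p by rewrite powR_gt0.
have X0 : 0 <= e1 * e2 + e3 * e4 by rewrite addr_ge0 ?mulr_ge0.
have XM : e1 * e2 + e3 * e4 <= 8 * (M `^ p * (M `^ n * M ^+ 3)).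
  apply: (@le_trans _ _ (2 * (M `^ p * M) * (2 * (M `^ n * M * M)) +
      2 * (M `^ n * M) * (2 * (M `^ p * M * M)))).
    by rewrite lerD// ler_pM.
  by rewrite le_eqVlt; apply/orP; left; apply/eqP; ring.
move=> LK.
have K0 : 0 < K.
  rewrite ltNge; apply/negP => K0; move: L0; rewrite ltNge => /negP; apply.
  by apply: (le_trans LK); rewrite mulr_le0_ge0// mulr_ge0_le0// invr_ge0.
have rp : (2 * N%:R / M) `^ p * M `^ p = (2 * N%:R) `^ p.
  rewrite -powRM ?divfK ?gt_eqF//; last exact: ltW.
  by rewrite divr_ge0 ?mulr_ge0// ltW.
rewrite mulrAC ler_pdivrMr ?mulr_gt0 ?exprn_gt0// -(@ler_pM2r _ (M `^ p))//.
rewrite -[leLHS]mulrA rp [leLHS]mulrC; apply: (le_trans LK).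
apply: (@le_trans _ _ (2^-1 * K * (8 * (M `^ p * (M `^ n * M ^+ 3))))).
  by rewrite ler_wpM2l// mulr_ge0 ?invr_ge0// ltW.
by rewrite le_eqVlt; apply/orP; left; apply/eqP; field.
Qed.

(** * The sharp constant and its growth rate *)

(** The infimum of the admissible constants is itself admissible, because the
inequality is linear in K with finite norms; the minimum in the definition of
sharpK therefore exists. *)
Lemma sharpK_between (R : realType) (d : nat) (p n C c : R) :
  n <= p -> admissible d p n C ->
  (forall K, admissible d p n K -> c <= K) ->
  c <= sharpK d p n <= C.
Proof.
move=> np aC lb; set S := admissible d p n.
have hS : has_inf S by split; [exists C | exists c => K; exact: lb].
have c_inf : c <= inf S by apply: lb_le_inf; [exists C | move=> K; exact: lb].
have minS : S (inf S).
  move=> v w vH wH.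
  have [_ _ v0 vp] := vH; have [_ _ w0 wp] := wH.
  have vn : (hnorm n v < +oo)%E by apply: le_lt_trans vp; exact: hnorm_mono.
  have wn : (hnorm (n + 1) w < +oo)%E.
    by apply: le_lt_trans wp; apply: hnorm_mono; rewrite lerD2r.
  have H (K : R) : S K -> _ := fun SK => SK v w vH wH.
  move: H; have [A [-> A0 _]] := hnorm_finP v0 vp.
  have [B [-> B0 _]] := hnorm_finP w0 wn.
  have [A' [-> A'0 _]] := hnorm_finP v0 vn.
  have [B' [-> B'0 _]] := hnorm_finP w0 wp.
  have [X X0 E] : exists2 X, 0 <= X & forall K : R, ((2^-1 * K)%:E *
      (A%:E * B%:E + A'%:E * B'%:E))%E = (2^-1 * K * X)%:E.
    by exists (A * B + A' * B') => //; rewrite addr_ge0 ?mulr_ge0.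
  rewrite E => H.
  have : (hnorm p (P_ v w) < +oo)%E.
    by apply: le_lt_trans (H _ aC) _; rewrite E ltry.
  have : (0 <= hnorm p (P_ v w))%E by exact: sqrte_ge0.
  case: (hnorm p _) H => [x| |] // H _ _.
  rewrite lee_fin; apply/ler_addgt0Pl => e e0.
  have e'0 : 0 < e / (X + 1) by rewrite divr_gt0// ltr_wpDl.
  have [K SK Kinf] := inf_adherent e'0 hS.
  have := H _ SK; rewrite E lee_fin => /le_trans; apply.
  apply: (@le_trans _ _ (2^-1 * (inf S + e / (X + 1)) * X)).
    by rewrite ler_wpM2r// ler_wpM2l ?invr_ge0// ltW.
  rewrite mulrDr mulrDl addrC lerD2r.
  have -> : 2^-1 * (e / (X + 1)) * X = (e * (2^-1 * X)) / (X + 1).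
    by field; rewrite gt_eqF// ltr_wpDl.
  by rewrite ler_pdivrMr ?ltr_wpDl// ler_pM2l//; lra.
have Sm : S (sharpK d p n) /\ lbound S (sharpK d p n).
  apply: (@xgetPex _ 0 [set K | S K /\ lbound S K]).
  by exists (inf S); split => // K SK; apply: ge_inf => //; exact: hS.2.
by rewrite lb ?Sm.2//; case: Sm.
Qed.

Lemma cvg_powR_inv (R : realType) (c : R) : 0 < c ->
  c `^ p^-1 @[p --> +oo] --> (1 : R).
Proof.
move=> c0; have cE p : c `^ p = expR (p * ln c) by rewrite /powR gt_eqF.
rewrite (_ : (fun p => c `^ p^-1) = (fun p => expR (p^-1 * ln c))); last first.
  by apply/funext => p; rewrite cE.
rewrite -expR0; apply: continuous_cvg; first exact: continuous_expR.
rewrite -[X in _ --> X](mul0r (ln c)); apply: cvgMr_tmp.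
apply/gtr0_cvgV0; last exact: cvg_id.
exact: nbhs_pinfty_gt.
Qed.

(** Squaring, the condition becomes r^2 < (4 - r^2) N^2, so N larger than
r^2 / (4 - r^2) will do. *)
Lemma exists_ratio_gt (R : realType) (r : R) : r < 2 ->
  exists2 N : nat, (0 < N)%N & r < 2 * N%:R / Num.sqrt (N%:R ^+ 2 + 1).
Proof.
move=> r2; have sq (N : nat) : 0 < Num.sqrt (N%:R ^+ 2 + 1) :> R.
  by rewrite sqrtr_gt0 ltr_wpDl ?sqr_ge0.
have [r0|r0] := leP r 0.
  exists 1%N => //; apply: (le_lt_trans r0); rewrite divr_gt0//.
have D0 : 0 < 4 - r ^+ 2 by nra.
set x := r ^+ 2 / (4 - r ^+ 2).
have x0 : 0 < x by rewrite divr_gt0// exprn_gt0.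
have xN := archi_boundP (ltW x0); set N := Num.bound x in xN.
have N0 : (0 < N)%N by rewrite -(ltr0n R) (lt_trans x0).
exists N => //; rewrite ltr_pdivlMr//.
rewrite -(@ltr_pXn2r _ 2)// ?nnegrE ?mulr_ge0 ?(ltW r0) ?(ltW (sq N))//.
rewrite !exprMn sqr_sqrtr ?addr_ge0 ?sqr_ge0//.
have N1 : 1 <= N%:R :> R by rewrite ler1n.
move: xN; rewrite /x ltr_pdivrMr// => xN.
have : N%:R * (4 - r ^+ 2) <= N%:R ^+ 2 * (4 - r ^+ 2).
  by rewrite ler_pM2r// expr2 ler_peMl// ltW// (lt_le_trans _ N1).
lra.
Qed.

Lemma powR_root (R : realType) (c x p : R) : 0 <= c -> 0 <= x -> 0 < p ->
  (c * x `^ p) `^ p^-1 = c `^ p^-1 * x.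
Proof.
move=> c0 x0 p0; rewrite powRM ?powR_ge0//.
by rewrite -powRrM divff ?gt_eqF// powRr1.
Qed.

Theorem proposition11p1 (R : realType) (d : nat) (hd : (2 <= d)%N)
    (n : R) (hn : d%:R / 2 < n) :
  sharpK d p n `^ p^-1 @[p --> +oo] --> (2 : R).
Proof.
have d0 : (0 < d)%N by apply: leq_trans hd.
have n0 : 0 < n by apply: le_lt_trans hn; rewrite divr_ge0.
have [C C0 HC] := admissible_pow2 d0 hn.
apply/cvgrPdist_le => e e0.
(* half of the tolerance is for the ratio, the other half for the p-th roots of
   the constants *)
have [|N N0] := @exists_ratio_gt R (2 - e / 2).
  by rewrite ltrBlDr ltrDl divr_gt0.
set rho := _ / _ => rhoN.
have rho0 : 0 < rho.
  by rewrite divr_gt0 ?mulr_gt0 ?ltr0n// sqrtr_gt0 ltr_wpDl ?sqr_ge0.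
have [c c0 Hc] : exists2 c : R, 0 < c & forall p K, 0 < p ->
    admissible d p n K -> c * rho `^ p <= K.
  by case: d hd {hn d0 HC} => [|[|d]]// _; exact: admissible_ge_pow.
near=> p.
have np : n <= p by near: p; apply: nbhs_pinfty_ge; exact: num_real.
have p0 : 0 < p by apply: lt_le_trans np.
have /andP[lo up] : c * rho `^ p <= sharpK d p n <= C * 2 `^ p.
  by apply: sharpK_between => //; [exact: HC|move=> K; exact: Hc].
have K0 : 0 <= sharpK d p n.
  by apply: le_trans lo; rewrite mulr_ge0 ?powR_ge0// ltW.
have ip : 0 <= p^-1 by rewrite invr_ge0 ltW.
have lo' : c `^ p^-1 * rho <= sharpK d p n `^ p^-1.
  rewrite -powR_root ?(ltW c0) ?(ltW rho0)//.
  by apply: ge0_ler_powR; rewrite ?nnegrE// mulr_ge0 ?powR_ge0// ltW.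
have up' : sharpK d p n `^ p^-1 <= C `^ p^-1 * 2.
  rewrite -powR_root ?(ltW C0)//.
  by apply: ge0_ler_powR; rewrite ?nnegrE// mulr_ge0 ?powR_ge0// ltW.
have nC : `|1 - C `^ p^-1| <= e / 2.
  near: p; apply: (@cvgr_dist_le _ _ _ _ _ _ _ (cvg_powR_inv C0)).
  by rewrite divr_gt0.
have nc : `|1 - c `^ p^-1| <= e / (2 * rho).
  near: p; apply: (@cvgr_dist_le _ _ _ _ _ _ _ (cvg_powR_inv c0)).
  by rewrite divr_gt0// mulr_gt0.
have nc' : rho - e / 2 <= c `^ p^-1 * rho.
  have : (1 - c `^ p^-1) * rho <= e / (2 * rho) * rho.
    by rewrite ler_pM2r// (le_trans (ler_norm _) nc).
  have -> : e / (2 * rho) * rho = e / 2 by field; exact: lt0r_neq0.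
  by rewrite mulrBl mul1r; lra.
rewrite distrC ler_norml; apply/andP; split.
  by move: lo' nc' rhoN; lra.
have : - (e / 2) <= 1 - C `^ p^-1 by rewrite ler_norml in nC; case/andP: nC.
by move: up'; lra.
Unshelve. all: by end_near. Qed.
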